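(* Let $S\subseteq\{-1,1,*\}^X$ be a binary hypothesis class and $B\subseteq([-1,1]\cup\{*\})^X$ a real-valued hypothesis class. For $\beta,\eta_2,\delta\in(0,1/2)$, letting $m:=\sup_{\theta\in\mathbb{R}}\mathsf{VC}(S,B^{(\theta)}_{\eta_2})$, \[ \#\mathsf{MA}(S,B,\beta+4\eta_2,\delta)\le O\!\left(\frac m{\beta^4}\log_+^2\!\left(\frac m\beta\right)+\frac1{\beta^4}\log\!\left(\frac1{\eta_2\beta\delta}\right)\right), \] \[ \#\mathsf{MC}(S,B,\beta+4\eta_2,\delta)\le O\!\left(\frac m{\beta^4}\log_+^2\!\left(\frac m\beta\right)+\frac1{\beta^4}\log\!\left(\frac1{\eta_2\beta\delta}\right)+\frac1{\beta^5}\right). \]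
   Context: $X$ non-empty; distributions discrete. For $b:X\to[-1,1]\cup\{*\}$, $\theta\in\mathbb{R}$, $\eta\ge0$: $b^{(\theta)}_\eta(x)=1$ if $b(x)\ne*$ and $b(x)>\theta+\eta$, $=-1$ if $b(x)\ne*$ and $b(x)<\theta-\eta$, $=*$ otherwise; $B^{(\theta)}_\eta=\{b^{(\theta)}_\eta:b\in B\}$. $\mathsf{VC}(H_1,H_2)$ for binary classes: sup of $|X'|$ over $X'$ shattered by both (every $\xi:X'\to\{-1,1\}$ agrees on $X'$ with a member). Generalized product $u_1\diamondsuit u_2=u_1u_2$ if $u_2\in[-1,1]$, $-|u_1|$ if $u_2=*$. For $\mu$ on $X\times[-1,1]$ and $f:X\to[-1,1]$: $\mathsf{MA\text{-}error}_{\mu,B}(f)=\sup_{b\in B}\sup_{\sigma\in\{\pm1\}}\mathbb{E}_\mu[((f(x)-y)\sigma)\diamondsuit b(x)]$; for $f$ with countable range $V$, $\mathsf{MC\text{-}error}_{\mu,B}(f)=\sup_{b\in B}\sum_{v\in V}\sup_{\sigma\in\{\pm1\}}\mathbb{E}_\mu[((f(x)-y)\mathbf{1}(f(x)=v)\sigma)\diamondsuit b(x)]$. $\mathsf{MA}_n(S,B,\varepsilon,\delta)$: learners taking $n$ points of $X\times[-1,1]$ and outputting $f:X\to[-1,1]$ such that for every $\mu$ with some $s\in S$ satisfying $\Pr_{x\sim\mu|_X}[s(x)\neq*]=1$ and $\mathbb{E}_\mu[y|x]=s(x)$, with probability $\ge1-\delta$ over $n$ i.i.d. samples, $\mathsf{MA\text{-}error}_{\mu,B}(f)\le\varepsilon$;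 $\mathsf{MC}_n$ likewise with $\mathsf{MC\text{-}error}$. $\#\mathsf{MA},\#\mathsf{MC}$: least such $n$. $\log_+(u)=\log_2\max\{2,u\}$. *)

(* Defs.v *)
From HB Require Import structures.
From mathcomp Require Import all_boot all_order all_algebra.
From mathcomp Require Import all_classical all_reals all_analysis.
From Stdlib Require List.
Set Implicit Arguments. Unset Strict Implicit. Unset Printing Implicit Defensive.
Import Order.TTheory GRing.Theory Num.Theory.
Local Open Scope classical_set_scope.
Local Open Scope ring_scope.

Section Defs.
Variable R : realType.

(* A partial hypothesis X -> [-1,1] u {*}: None encodes *. *)

Definition ssum (T : choiceType) (D : set T) (u : T -> \bar R) : \bar R :=
  (\esum_(i in D) maxe (u i) 0%E - \esum_(i in D) maxe (- u i) 0%E)%E.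

(* A discrete distribution mu on X x [-1,1] is represented by its atoms:
   mass p i >= 0 at point a i, total mass 1. *)
Definition is_ddist (X : Type) (p : nat -> R) (a : nat -> X * R) : Prop :=
  (forall i, 0 <= p i) /\ (\esum_(i in [set: nat]) (p i)%:E = 1%E) /\
  (forall i, -1 <= (a i).2 <= 1).

Definition Ex (X : Type) (p : nat -> R) (a : nat -> X * R) (g : X * R -> R) : \bar R :=
  ssum [set: nat] (fun i => (p i * g (a i))%:E).

Definition gprod (u : R) (b : option R) : R :=
  match b with Some r => u * r | None => - `|u| end.

Definition MA_error (X : Type) (p : nat -> R) (a : nat -> X * R)
  (B : set (X -> option R)) (f : X -> R) : \bar R :=
  ereal_sup [set e | exists b sigma, B b /\ (sigma = 1 \/ sigma = -1) /\
     e = Ex p a (fun xy => gprod ((f xy.1 - xy.2) * sigma) (b xy.1))].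

Definition MC_error (X : Type) (p : nat -> R) (a : nat -> X * R)
  (B : set (X -> option R)) (f : X -> R) : \bar R :=
  ereal_sup [set e | exists b, B b /\
     e = ssum (range f) (fun v =>
           maxe (Ex p a (fun xy => gprod ((f xy.1 - xy.2) * \1_[set v] (f xy.1)) (b xy.1)))
                (Ex p a (fun xy => gprod ((f xy.1 - xy.2) * \1_[set v] (f xy.1) * -1) (b xy.1))))].

(* mu is realizable by s in S: Pr[s(x) <> *] = 1 and E[y|x] = s(x) *)
Definition realizable (X : Type) (S : set (X -> option R))
  (p : nat -> R) (a : nat -> X * R) : Prop :=
  exists s, S s /\ (forall i, 0 < p i -> s (a i).1 <> None) /\
    (forall x r, s x = Some r ->
       Ex p a (fun xy => (xy.2 - r) * \1_[set x] xy.1) = 0%E).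

Definition sample_prob (n : nat) (p : nat -> R) (good : n.-tuple nat -> Prop) : \bar R :=
  \esum_(t in [set t | good t]) (\prod_(k < n) p (tnth t k))%:E.

Definition learner_outputs_ok (X : Type) (n : nat)
  (A : n.-tuple (X * R) -> X -> R) : Prop :=
  forall smp x, -1 <= A smp x <= 1.

Definition MA_learner (X : Type) (S B : set (X -> option R)) (eps delta : R)
  (n : nat) (A : n.-tuple (X * R) -> X -> R) : Prop :=
  learner_outputs_ok A /\
  forall p a, is_ddist p a -> realizable S p a ->
    ((1 - delta)%:E <= sample_prob p
        (fun t => MA_error p a B (A (map_tuple a t)) <= eps%:E))%E.

Definition MC_learner (X : Type) (S B : set (X -> option R)) (eps delta : R)
  (n : nat) (A : n.-tuple (X * R) -> X -> R) : Prop :=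
  learner_outputs_ok A /\ (forall smp, countable (range (A smp))) /\
  forall p a, is_ddist p a -> realizable S p a ->
    ((1 - delta)%:E <= sample_prob p
        (fun t => MC_error p a B (A (map_tuple a t)) <= eps%:E))%E.

Definition binary_class (X : Type) (S : set (X -> option R)) : Prop :=
  forall s x, S s -> s x = None \/ s x = Some 1 \/ s x = Some (-1).

Definition real_class (X : Type) (B : set (X -> option R)) : Prop :=
  forall b x r, B b -> b x = Some r -> -1 <= r <= 1.

Definition thr (X : Type) (theta eta : R) (b : X -> option R) : X -> option R :=
  fun x => match b x with
           | Some r => if theta + eta < r then Some 1
                       else if r < theta - eta then Some (-1) else None
           | None => None
           end.

(* the finite set given by (duplicate-free) s is shattered by H *)
Definition shattered (X : Type) (H : set (X -> option R)) (s : seq X) : Prop :=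
  forall xi : X -> bool, exists h, H h /\
    forall x, List.In x s -> h x = Some (if xi x then 1 else -1).

Definition VC_le (X : Type) (S B : set (X -> option R)) (eta : R) (m : nat) : Prop :=
  forall theta (s : seq X), List.NoDup s -> shattered S s ->
    shattered (thr theta eta @` B) s -> (size s <= m)%N.

Definition logp (u : R) : R := ln (Num.max 2 u) / ln 2.

End Defs.

(* Main.v *)
(* Labels are noiseless under realizability, since E[y|x] = s(x) = +-1 and |y| <= 1.  The learner is
   a sample compression scheme: it keeps a function with values on the grid k/q - 1 and, as long as
   some b in B has large empirical correlation with the residual, moves every value one grid step
   towards the prediction of a boosted majority vote.  Averaging b over q thresholds and restricting
   to the points where the threshold function agrees with the label gives a partial class whose VC
   dimension is at most m; its one-inclusion predictors are weak learners described by O(m) sample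
   points.  Each round lowers the empirical squared loss by n/q^2, so q^2 rounds suffice.  The points
   outside the compression set are a fresh sample, so Chernoff's bound and a union bound over the
   codes give the generalization guarantee. *)

Require Import Defs.
From HB Require Import structures.
From mathcomp Require Import all_boot all_order all_algebra.
From mathcomp Require Import all_classical all_reals all_analysis.
From mathcomp Require Import zify ring lra.
From Stdlib Require List.
Set Implicit Arguments. Unset Strict Implicit. Unset Printing Implicit Defensive.
Import Order.TTheory GRing.Theory Num.Theory.
Local Open Scope classical_set_scope.
Local Open Scope ring_scope.

(** For partial classes a finite VC dimension gives neither a Sauer bound nor uniform convergence,
    so nothing is estimated uniformly over [B]. A code fixes the output; if the output is
    inaccurate, one violating [b] is picked from the output alone, and only this [b] is tested on
    the points outside the code. The agreement class is where [S] and [B] meet: a set that it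
    shatters is shattered by [S] through the labels, and by the thresholded [B] up to the fixed
    signs of the round. Off the agreement set the generalized product already has its least value,
    so a wrong vote costs nothing there. Rates: [q] is of order [1/beta], hence [1/beta^2] rounds,
    and Chernoff's bound at accuracy [beta] costs another [1/beta^2]. One logarithm comes from
    boosting to an error of order [beta], the other from [ln n], the cost of naming a sample point.
    For multicalibration each round also names a sign for each of the [2q + 1] levels, which gives
    the term [1/beta^5]. *)

(** * One-inclusion graphs: edge density and prediction *)

Section OneInclusion.
Local Open Scope nat_scope.
Local Open Scope set_scope.
Variable T : finType.
Implicit Types (A E : {set T}) (D : {set T}) (F G : {set {set T}}).

Definition flip (j : T) A : {set T} := if j \in A then A :\ j else j |: A.

Definition fshatters F D :=
  forall E, E \subset D -> exists2 A, A \in F & A :&: D = E.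

Lemma in_flip i j A : (i \in flip j A) = if i == j then j \notin A else i \in A.
Proof.
rewrite /flip; case: ifP => jA; rewrite !inE; case: eqP => [->|_] //=.
Qed.

Lemma flipK j : involutive (flip j).
Proof.
by move=> A; apply/finset.setP => i; rewrite !in_flip eqxx; case: eqP => [->|//]; rewrite negbK.
Qed.

Lemma flipC i j A : flip i (flip j A) = flip j (flip i A).
Proof.
apply/finset.setP => k; rewrite !in_flip.
have [->|ki] := eqVneq k i; last by case: (eqVneq k j) => // kj; rewrite -kj (negbTE ki).
by case: (eqVneq i j) => [->|//]; rewrite ?eqxx.
Qed.

(** Every edge is counted from both ends. Only directions in [D] count, so that an induction can
    drop a direction while the ground type [T] stays fixed. *)
Definition halfedges D F :=
  \sum_(A : {set T}) \sum_(j in D) ((A \in F) && (flip j A \in F) : nat).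

Lemma sum_split_flip (x : T) (f : {set T} -> nat) :
  \sum_A f A = \sum_(A : {set T} | x \notin A) (f A + f (flip x A)).
Proof.
rewrite (bigID (fun A : {set T} => x \notin A)) /= big_split /=; congr (_ + _).
rewrite (reindex_inj (inv_inj (flipK x))) /=; apply: eq_bigl => A.
by rewrite in_flip eqxx !negbK.
Qed.

(* Haussler's density bound: a family of VC dimension d spans at most d|F| edges of the cube. *)
Lemma halfedges_le D F d :
  (forall E, E \subset D -> fshatters F E -> #|E| <= d) ->
  halfedges D F <= (2 * d * #|F|).
Proof.
move: {2}#|D| (erefl #|D|) => k; elim: k => [|k IH] in D F d *.
  move/eqP; rewrite cards_eq0 => /eqP -> _.
  by rewrite /halfedges big1 // => A _; rewrite big_set0.
move=> Dk vc.
have /card_gt0P[x xD] : 0 < #|D| by rewrite Dk.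
have Dk' : #|D :\ x| = k by move: Dk; rewrite (cardsD1 x D) xD add1n => -[].
(* [U] is the projection of [F] along [x] and [I] the set of double fibres, so [#|F| = #|U| + #|I|].
   The edges along [x] correspond to the members of [I]; the half-edges in other directions are
   bounded by those of [U] and [I] together. A set shattered by [I] stays shattered by [F] after
   adding [x], so the bound for [I] is [d - 1]. *)
pose U := [set A : {set T} | (x \notin A) && ((A \in F) || (flip x A \in F))].
pose I := [set A : {set T} | (x \notin A) && ((A \in F) && (flip x A \in F))].
have cardE (G : {set {set T}}) : #|G| = \sum_(A : {set T}) (A \in G : nat).
  by rewrite -sum1_card big_mkcond.
have cF : #|F| = #|U| + #|I|.
  rewrite !cardE (sum_split_flip x) (sum_split_flip x (fun A => A \in U : nat)).
  rewrite (sum_split_flip x (fun A => A \in I : nat)) -big_split /=.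
  apply: eq_bigr => A xA; rewrite !inE !in_flip eqxx xA /=.
  by case: (A \in F); case: (flip x A \in F).
have xE E : E \subset D :\ x -> x \notin E.
  by move=> s; apply/negP => /(fintype.subsetP s); rewrite !inE eqxx.
have flipI A E : x \notin E -> flip x A :&: E = A :&: E.
  move=> xE'; apply/finset.setP => i; rewrite !inE in_flip.
  by case: eqP => // ->; rewrite (negbTE xE') !andbF.
have vcU E : E \subset D :\ x -> fshatters U E -> #|E| <= d.
  move=> sE sh; apply: vc; first by apply: fintype.subset_trans sE (finset.subD1set _ _).
  move=> E' /sh[A]; rewrite inE => /andP[_ /orP[AF|AF]] AE; first by exists A.
  by exists (flip x A) => //; rewrite flipI // xE.
have vcI E : E \subset D :\ x -> fshatters I E -> #|E| < d.
  move=> sE sh; have := vc (x |: E); rewrite cardsU1 xE // add1n; apply.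
    by rewrite finset.subUset finset.sub1set xD; apply: fintype.subset_trans sE (finset.subD1set _ _).
  move=> E' sE'; have [|A] := sh (E' :\ x).
    by rewrite subDset.
  rewrite inE => /and3P[xA AF AF'] /finset.setP AE.
  pose A' := if x \in E' then flip x A else A.
  exists A'; first by rewrite /A'; case: ifP.
  apply/finset.setP => i; have := AE i; rewrite !inE /A'.
  case: (eqVneq i x) => [->|ix] /=.
    by rewrite andbT; case: ifP; rewrite ?in_flip ?eqxx ?xA // (negbTE xA).
  by case: ifP => _; rewrite ?in_flip ?(negbTE ix).
have eUI : halfedges (D :\ x) F <= halfedges (D :\ x) U + halfedges (D :\ x) I.
  rewrite /halfedges (sum_split_flip x).
  rewrite -[X in _ <= X]big_split /= [X in X <= _]big_mkcond /=.
  apply: leq_sum => A _; case: ifP => // xA.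
  rewrite -!big_split /=; apply: leq_sum => j; rewrite !inE => /andP[jx _].
  rewrite !in_flip xA [x == j]eq_sym (negbTE jx) xA /= (flipC x j A).
  by case: (A \in F); case: (flip x A \in F); case: (flip j A \in F);
    case: (flip j (flip x A) \in F).
have ex : halfedges D F <= 2 * #|I| + halfedges (D :\ x) F.
  rewrite /halfedges.
  have -> : \sum_(A : {set T}) \sum_(j in D) ((A \in F) && (flip j A \in F) : nat) =
    \sum_(A : {set T}) ((A \in F) && (flip x A \in F) : nat) +
    \sum_(A : {set T}) \sum_(j in D :\ x) ((A \in F) && (flip j A \in F) : nat).
    by rewrite -big_split /=; apply: eq_bigr => A _; rewrite (big_setD1 x) //=.
  rewrite leq_add2r (sum_split_flip x) cardE big_distrr /= [X in X <= _]big_mkcond /=.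
  apply: leq_sum => A _; case: ifP => // xA; rewrite flipK !inE xA /=.
  by case: (A \in F); case: (flip x A \in F).
have iU := IH _ U d Dk' vcU.
(* [d.-1] is a true decrease only if [0 < d]. A member of [I] ensures this, since the empty set is
   then shattered by [I]. *)
have [I0|] := posnP #|I|.
  have I0' : I = finset.set0 by apply/eqP; rewrite -cards_eq0 I0.
  have e0 : halfedges (D :\ x) I = 0.
    by rewrite /halfedges big1 // => A _; rewrite big1 // => j _; rewrite I0' inE.
  rewrite cF I0 addn0; apply: leq_trans iU; apply: leq_trans ex _.
  by rewrite I0 muln0 add0n; apply: leq_trans eUI _; rewrite e0 addn0.
case/card_gt0P => A0 A0I.
have d0 : 0 < d.
  apply: leq_ltn_trans (vcI finset.set0 _ _) => //; first by rewrite finset.sub0set.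
  by move=> E; rewrite finset.subset0 => /eqP ->; exists A0 => //; rewrite finset.setI0.
have iI := IH _ I d.-1 Dk' (fun E sE sh => ltac:(have := vcI E sE sh; lia)).
have h3 : 2 * d.-1 * #|I| + 2 * #|I| = 2 * d * #|I|.
  by rewrite -mulnDl -{2}[2]muln1 -mulnDr addn1 prednK.
rewrite cF mulnDr -h3 [X in _ <= _ + X]addnC addnCA; apply: leq_trans ex _.
by rewrite leq_add2l; apply: leq_trans eUI _; rewrite leq_add.
Qed.

(* Peel off a vertex of minimal degree and let it carry all the errors on its own edges. *)
Lemma one_inclusion_predictor F d :
  (forall D, fshatters F D -> #|D| <= d) ->
  exists pred : T -> {set T} -> bool,
    (forall j A, pred j (flip j A) = pred j A) /\
    (forall A, A \in F -> #|[set j | pred j A != (j \in A)]| <= 2 * d).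
Proof.
move: {2}#|F| (erefl #|F|) => k; elim: k F => [|k IH] F.
  move/eqP; rewrite cards_eq0 => /eqP -> _; exists (fun _ _ => false).
  by split => // A; rewrite inE.
move=> Fk vc.
(* The density bound makes the average degree at most [2 * d], hence also the minimal one. *)
have [A0 A0F degA0] : exists2 A, A \in F & \sum_(j : T) (flip j A \in F : nat) <= 2 * d.
  apply/exists_inP; apply: contraT; rewrite negb_exists_in => /forall_inP dg.
  have := @halfedges_le finset.setT F d (fun E _ => vc E); rewrite leqNgt => /negP[].
  rewrite /halfedges (bigID (mem F)) /=.
  apply: leq_trans (leq_addr _ _).
  apply: (@leq_trans (\sum_(A in F) (2 * d).+1)).
    by rewrite big_const_seq /= count_filter -enumT -size_filter -cardE iter_addn_0 mulSn
      -[X in X < _]add0n ltn_add2r Fk || rewrite sum_nat_const Fk mulnC ltn_pmul2l.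
  apply: leq_sum => A AF; apply: leq_trans (_ : \sum_(j : T) (flip j A \in F : nat) <= _).
    by rewrite ltnNge dg.
  by rewrite big_mkcond [X in _ <= X]big_mkcond /=; apply: leq_sum => j _; rewrite inE AF.
have [pred [predC predE]] : exists pred : T -> {set T} -> bool,
    (forall j A, pred j (flip j A) = pred j A) /\
    (forall A, A \in F :\ A0 -> #|[set j | pred j A != (j \in A)]| <= 2 * d).
  apply: IH.
    by move: Fk; rewrite (cardsD1 A0) A0F add1n => -[].
  move=> D sh; apply: vc => E /sh[A]; rewrite !inE => /andP[_ AF] <-; by exists A.
pose p j A := if (A == A0) || (flip j A == A0) then
   (if flip j A0 \in F then j \notin A0 else j \in A0) else pred j A.
exists p; split.
  by move=> j A; rewrite /p flipK orbC predC.
move=> A AF; have [->|AA0] := eqVneq A A0.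
  apply: leq_trans degA0.
  rewrite -sum1_card big_mkcond; apply: leq_sum => j _; rewrite !inE /p eqxx /=.
  by case: (flip j A0 \in F); case: (j \in A0).
apply: leq_trans (predE A _); last by rewrite !inE AA0.
apply: subset_leq_card; apply/fintype.subsetP => j; rewrite !inE /p (negbTE AA0) /=.
by case: (flip j A =P A0) => // <-; rewrite flipK AF in_flip eqxx negbK eqxx.
Qed.

End OneInclusion.

(** * Weak learning of partial classes by leave-one-out prediction *)

Lemma InP (T : eqType) (x : T) (s : seq T) : reflect (List.In x s) (x \in s).
Proof.
elim: s => [|y s IH] /=; first by constructor.
rewrite inE; apply: (iffP orP) => -[].
- by move/eqP->; left.
- by move/IH; right.
- by move->; left.
- by move/IH; right.
Qed.

Definition vcdim_le (X : Type) (H : set (X -> option bool)) (d : nat) :=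
  forall s : seq X, List.NoDup s ->
    (forall xi : X -> bool, exists2 h, H h & forall x, List.In x s -> h x = Some (xi x)) ->
    (size s <= d)%N.

Definition replace (J : eqType) (U : Type) (z : J -> U) (j : J) (u : U) : J -> U :=
  fun i => if i == j then u else z i.

Section Resample.
Variables (R : realType) (I : finType) (N : nat).
Implicit Types (w : I -> R) (Z : {ffun 'I_N -> I}).

Lemma prod_replace w (z : 'I_N -> I) j i :
  (\prod_k w (replace z j i k)) * w (z j) = (\prod_k w (z k)) * w i.
Proof.
rewrite (bigD1 j) //= [in RHS](bigD1 j) //= /replace eqxx.
rewrite (eq_bigr (fun k => w (z k))) => [|k /negbTE ->//].
ring.
Qed.

(** Exchanging coordinate [j] with a fresh draw [i] is an involution that preserves the weight
    [(\prod_k w (Z k)) * w i]. The weights are not normalised, hence the factor [\sum_i w i]. *)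
Lemma ffun_resample w (G : {ffun 'I_N -> I} -> R) j :
  (\sum_(Z : {ffun 'I_N -> I}) (\prod_k w (Z k)) * G Z) * \sum_i w i =
  \sum_(Z : {ffun 'I_N -> I}) (\prod_k w (Z k)) * \sum_i w i * G [ffun k => replace Z j i k].
Proof.
pose phi (p : {ffun 'I_N -> I} * I) : {ffun 'I_N -> I} * I :=
  ([ffun k => replace p.1 j p.2 k], p.1 j).
have phiK : involutive phi.
  case=> Z i; rewrite /phi /= !ffunE /replace eqxx; congr (_, _).
  by apply/ffunP => k; rewrite !ffunE; case: eqP => [->|].
have -> : (\sum_(Z : {ffun 'I_N -> I}) (\prod_k w (Z k)) * G Z) * (\sum_i w i) =
    \sum_(p : {ffun 'I_N -> I} * I) (\prod_k w (p.1 k)) * G p.1 * w p.2.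
  rewrite mulr_suml -(pair_bigA _ (fun Z i => (\prod_k w (Z k)) * G Z * w i)) /=.
  by apply: eq_bigr => Z _; rewrite mulr_sumr.
have -> : \sum_(Z : {ffun 'I_N -> I}) (\prod_k w (Z k)) * (\sum_i w i * G [ffun k => replace Z j i k]) =
    \sum_(p : {ffun 'I_N -> I} * I) (\prod_k w (p.1 k)) * (w p.2 * G (phi p).1).
  rewrite -(pair_bigA _ (fun Z i => (\prod_k w (Z k)) * (w i * G (phi (Z, i)).1))) /=.
  by apply: eq_bigr => Z _; rewrite mulr_sumr.
rewrite (reindex_inj (inv_inj phiK)); apply: eq_bigr => -[Z i] _ /=.
rewrite mulrAC mulrA; congr (_ * _).
by rewrite -(prod_replace w Z j i); congr (_ * _); apply: eq_bigr => k _; rewrite ffunE.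
Qed.

End Resample.

Section WeakLearner.
Variables (R : realType) (X : Type) (H : set (X -> option bool)) (d : nat).
Hypothesis vcH : vcdim_le H d.

(** Only hypotheses defined at all points of [z] count; this turns a partial class into an ordinary
    family of subsets. *)
Definition patterns N (z : 'I_N -> X) : {set {set 'I_N}} :=
  [set A : {set 'I_N} | `[< exists2 h, H h & forall j, h (z j) = Some (j \in A) >]]%SET.

Lemma patterns_vc N (z : 'I_N -> X) D : fshatters (patterns z) D -> (#|D| <= d)%N.
Proof.
move=> sh.
(* A repeated point cannot receive two labels, so the indices in a shattered set carry distinct
   points. *)
have zinj i j : i \in D -> j \in D -> z i = z j -> i = j.
  move=> iD jD zij; apply/eqP; apply: contraT => ij.
  have [|A] := sh [set i]%SET; first by rewrite finset.sub1set.
  rewrite inE => /asboolP[h _ hA] /finset.setP AE.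
  have := AE i; have := AE j; rewrite !inE iD jD eqxx !andbT (eq_sym j) (negbTE ij) => jA iA.
  by have := hA i; rewrite zij hA iA jA.
have /vcH : List.NoDup [seq z j | j <- enum D].
  have : {subset enum D <= D} by move=> i; rewrite mem_enum.
  elim: (enum D) (enum_uniq D) => [|i s IH] /= => [_ _|/andP[iNs us] sD]; first by constructor.
  constructor; last by apply: IH => // k ks; apply: sD; rewrite inE ks orbT.
  move=> /List.in_map_iff[k [zk /InP ks]].
  suff ki : k = i by rewrite ki (negbTE iNs) in ks.
  by apply: zinj zk; apply: sD; rewrite inE ?eqxx ?ks ?orbT.
rewrite size_map -cardE; apply => xi.
have [|A] := sh [set j in D | xi (z j)]%SET.
  by apply/fintype.subsetP => j; rewrite inE => /andP[].
rewrite inE => /asboolP[h Hh hA] /finset.setP AE; exists h => // x.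
move=> /List.in_map_iff[k [<- /InP]]; rewrite mem_enum => kD.
by rewrite hA; have := AE k; rewrite !inE kD /= andbT => ->.
Qed.

(** The predictor is chosen from the family alone, that is, from the unlabelled points. *)
Definition oi_pred (T : finType) (F : {set {set T}}) : T -> {set T} -> bool :=
  match pselect (exists pred : T -> {set T} -> bool,
    (forall j A, pred j (flip j A) = pred j A) /\
    (forall A, A \in F -> #|[set j | pred j A != (j \in A)]%SET| <= 2 * d)%N) with
  | left e => projT1 (cid e)
  | right _ => fun _ _ => false
  end.

Lemma oi_predP (T : finType) (F : {set {set T}}) :
  (forall D, fshatters F D -> #|D| <= d)%N ->
  (forall j A, oi_pred F j (flip j A) = oi_pred F j A) /\
  (forall A, A \in F -> #|[set j | oi_pred F j A != (j \in A)]%SET| <= 2 * d)%N.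
Proof.
move=> /one_inclusion_predictor e; rewrite /oi_pred; case: pselect => // e'.
exact: (projT2 (cid e')).
Qed.

(** The query [x] takes the place of the [j]-th sample point. The stale label [lab j] does no harm
    because the predictor is invariant under flips in direction [j]. *)
Definition weakh N (z : 'I_N -> X) (lab : 'I_N -> bool) (j : 'I_N) (x : X) : bool :=
  oi_pred (patterns (replace z j x)) j [set i | lab i]%SET.

Variables (I : finType) (x : I -> X) (y : I -> bool) (w : I -> R) (h : X -> option bool).
Hypotheses (Hh : H h) (w0 : forall i, 0 <= w i)
  (hw : forall i, 0 < w i -> h (x i) = Some (y i)).

Let err N (Z : {ffun 'I_N -> I}) j i := weakh (x \o Z) (y \o Z) j (x i) != y i.

Let errZ N (Z : {ffun 'I_N -> I}) j := err Z j (Z j).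

(** The two label sets agree off [j], so they are equal or flips of each other. This identifies the
    leave-one-out error on a resampled tuple with the error at a fresh point. *)
Lemma errZ_replace N (Z : {ffun 'I_N -> I}) j i :
  errZ [ffun k => replace Z j i k] j = err Z j i.
Proof.
have rj : replace Z j i j = i by rewrite /replace eqxx.
rewrite /errZ /err ffunE rj /weakh.
congr (_ != _); set F1 := patterns _; set F2 := patterns (replace (x \o Z) j _).
have -> : F1 = F2.
  congr patterns; apply/funext => k; rewrite /replace; case: eqP => //= kj.
  by rewrite ffunE (introF eqP kj).
have [pC _] := oi_predP (@patterns_vc _ (replace (x \o Z) j (x i))).
set A1 := [set _ | _]%SET; set A2 := [set _ | _]%SET.
have AE k : k != j -> (k \in A1) = (k \in A2).
  by move=> kj; rewrite !inE /= ffunE /replace (negbTE kj).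
have [jA|jA] := eqVneq (j \in A1) (j \in A2).
  by congr oi_pred; apply/finset.setP => k; have [->//|/AE] := eqVneq k j.
rewrite -pC; congr oi_pred; apply/finset.setP => k; rewrite in_flip.
have [->|/AE//] := eqVneq k j.
by move: jA; case: (j \in A1); case: (j \in A2).
Qed.

(* Averaging the one-inclusion bound over N samples drawn with weights w: by exchangeability of
   coordinate j with a fresh draw, some training tuple predicts a fresh point well. *)
Lemma weak_learner N (i0 : I) : (0 < N)%N ->
  exists Z : {ffun 'I_N -> I}, exists j : 'I_N,
    N%:R * (\sum_(i | weakh (x \o Z) (y \o Z) j (x i) != y i) w i) <= (2 * d)%:R * \sum_i w i.
Proof.
move=> N0; pose W := \sum_i w i; pose P (Z : {ffun 'I_N -> I}) := \prod_k w (Z k).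
have W0 : 0 <= W by apply: sumr_ge0.
have [WZ|Wpos] := eqVneq W 0.
  exists [ffun=> i0], (Ordinal N0); rewrite -/W WZ mulr0 big1 ?mulr0 // => i _.
  by apply/eqP; move/eqP: WZ; rewrite psumr_eq0 // => /allP/(_ i (mem_index_enum _)).
have {Wpos}Wpos : 0 < W by rewrite lt_neqAle eq_sym Wpos.
have P0 Z : 0 <= P Z by apply: prodr_ge0.
have PW : \sum_(Z : {ffun 'I_N -> I}) P Z = W ^+ N.
  have <- : \prod_(k < N) W = W ^+ N by rewrite prodr_const card_ord.
  by rewrite /W bigA_distr_bigA.
(* If [Z] has positive weight, [h] is defined and correct on all its points, so the label set
   belongs to the family and at most [2 * d] leave-one-out predictions fail. *)
have bound Z : P Z * \sum_(j < N) (errZ Z j)%:R <= P Z * (2 * d)%:R.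
  have [->|PZ] := eqVneq (P Z) 0; first by rewrite !mul0r.
  rewrite ler_wpM2l // -natr_sum ler_nat.
  have wp k : 0 < w (Z k).
    rewrite lt_neqAle w0 andbT eq_sym; apply: contraNneq PZ => wk.
    by rewrite /P (bigD1 k) //= wk mul0r.
  have [_ /(_ [set k | y (Z k)]%SET)] := oi_predP (@patterns_vc _ (x \o Z)).
  have -> : [set k | y (Z k)]%SET \in patterns (x \o Z).
    by rewrite inE; apply/asboolP; exists h => // j; rewrite inE hw.
  move=> /(_ isT); apply: leq_trans; rewrite -sum1_card [X in (_ <= X)%N]big_mkcond.
  apply: leq_sum => j _; rewrite inE /errZ /err /weakh inE.
  have -> : replace (x \o Z) j (x (Z j)) = x \o Z.
    by apply/funext => k; rewrite /replace; case: eqP => [->|].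
  by case: (_ != _).
apply: contrapT => /forallNP nex.
have {}nex (Z : {ffun 'I_N -> I}) j : (2 * d)%:R * W < N%:R * \sum_i w i * (err Z j i)%:R.
  rewrite ltNge; apply/negP => le; case: (nex Z); exists j.
  apply: le_trans le; rewrite ler_wpM2l // big_mkcond; apply: ler_sum => i _.
  by rewrite /err; case: (_ != _); rewrite ?mulr1 // mulr0.
have tot : \sum_(Z : {ffun 'I_N -> I}) P Z * (\sum_(j < N) (errZ Z j)%:R) <= W ^+ N * (2 * d)%:R.
  by rewrite -PW mulr_suml; apply: ler_sum => Z _; exact: bound.
have : (\sum_(Z : {ffun 'I_N -> I}) P Z * (\sum_(j < N) (errZ Z j)%:R)) * W * N%:R <=
    W ^+ N * (2 * d)%:R * W * N%:R by rewrite !ler_wpM2r.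
have -> : (\sum_(Z : {ffun 'I_N -> I}) P Z * (\sum_(j < N) (errZ Z j)%:R)) * W * N%:R =
  \sum_(j < N) \sum_(Z : {ffun 'I_N -> I}) P Z * (N%:R * \sum_i w i * (err Z j i)%:R).
  rewrite (eq_bigr (fun Z => \sum_(j < N) P Z * (errZ Z j)%:R)); last first.
    by move=> Z _; rewrite mulr_sumr.
  rewrite exchange_big /= mulr_suml mulr_suml; apply: eq_bigr => j _.
  rewrite (ffun_resample w (fun Z => (errZ Z j)%:R) j) mulr_suml; apply: eq_bigr => Z _.
  rewrite -mulrA [_ * N%:R]mulrC; congr (_ * (_ * _)).
  by apply: eq_bigr => i _; rewrite errZ_replace.
apply/negP; rewrite -ltNge.
have -> : W ^+ N * (2 * d)%:R * W * N%:R = \sum_(j < N) \sum_(Z : {ffun 'I_N -> I}) P Z * ((2 * d)%:R * W).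
  by rewrite sumr_const card_ord -mulr_suml PW -mulr_natr; ring.
(* The contradiction needs a strict inequality, which only tuples of positive weight provide. *)
have [Z0 PZ0] : exists Z, 0 < P Z.
  have : W ^+ N != 0 by rewrite expf_neq0 // gt_eqF.
  rewrite -PW => /negP nz; apply: contrapT => /forallNP np; apply: nz.
  rewrite big1 // => Z _; apply/eqP; rewrite eq_le P0 andbT leNgt; exact/negP.
rewrite [X in X < _]exchange_big [X in _ < X]exchange_big /=.
rewrite (bigD1 Z0) //= [X in _ < X](bigD1 Z0) //=; apply: ltr_leD.
  rewrite (bigD1 (Ordinal N0)) //= [X in _ < X](bigD1 (Ordinal N0)) //=.
  by apply: ltr_leD; [rewrite ltr_pM2l|apply: ler_sum => j _; rewrite ler_pM2l // ltW].
by apply: ler_sum => Z _; apply: ler_sum => j _; rewrite ler_wpM2l // ltW.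
Qed.

End WeakLearner.

(** * Boosting the weak learner to a majority vote *)

Section Boosting.
Variables (R : realType) (X : Type) (H : set (X -> option bool)) (d : nat).
Hypothesis vcH : vcdim_le H d.
Variables (I : finType) (x : I -> X) (y : I -> bool).

Definition weak_code (N : nat) : Type := ({ffun 'I_N -> I} * 'I_N)%type.

Definition decode N (c : weak_code N) : X -> bool :=
  weakh H d (x \o c.1) (y \o c.1) c.2.

Definition vote N (cs : seq (weak_code N)) (u : X) : bool :=
  (size cs < 2 * count (fun c => decode c u) cs)%N.

Variables (w : I -> R) (h : X -> option bool).
Hypotheses (Hh : H h) (w0 : forall i, 0 <= w i)
  (hw : forall i, 0 < w i -> h (x i) = Some (y i)).

Let nwrong N (cs : seq (weak_code N)) i : nat :=
  count (fun c => decode c (x i) != y i) cs.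

Lemma vote_wrong N (cs : seq (weak_code N)) i :
  vote cs (x i) != y i -> (size cs <= 2 * nwrong cs i)%N.
Proof.
have := count_predC (fun c => decode c (x i)) cs.
rewrite /vote /nwrong; case: (y i).
  rewrite eqb_id -leqNgt.
  rewrite (@eq_count _ (fun c => decode c (x i) != true) (predC (fun c => decode c (x i)))).
    lia.
  by move=> c /=; rewrite eqb_id.
rewrite eqbF_neg negbK (@eq_count _ (fun c => decode c (x i) != false) (fun c => decode c (x i))).
  lia.
by move=> c /=; rewrite eqbF_neg negbK.
Qed.

(* Doubling the weight of a misclassified point and halving the others shrinks the total by 7/8
   when the weighted error is at most 1/4. *)
Lemma boosting N T (i0 : I) : (0 < N)%N -> (8 * d <= N)%N ->
  exists cs : T.-tuple (weak_code N),
    \sum_(i | vote cs (x i) != y i) w i <= (7 / 8) ^+ T * \sum_i w i.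
Proof.
move=> N0 dN.
(* The factor is 2 to the number of wrong voters minus the number of right ones. It is at least 1
   where the vote errs, so the total of [v] bounds the weight of the misclassified points. *)
pose v (cs : seq (weak_code N)) i := w i * 2 ^+ (2 * nwrong cs i) / 2 ^+ size cs.
have v0 cs i : 0 <= v cs i by rewrite /v divr_ge0 // ?mulr_ge0 // exprn_ge0.
suff [cs csT] : exists cs : T.-tuple (weak_code N),
    \sum_i v cs i <= (7 / 8) ^+ T * \sum_i w i.
  exists cs; apply: le_trans csT; rewrite big_mkcond; apply: ler_sum => i _.
  case: ifP => // /vote_wrong le; rewrite /v ler_pdivlMr ?exprn_gt0 //.
  by rewrite ler_wpM2l // ler_eXn2l // ltr1n.
elim: T => [|T [cs csT]].
  exists [tuple]; rewrite expr0 mul1r; apply: ler_sum => i _.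
  by rewrite /v /nwrong /= muln0 expr0 mulr1 divr1.
have [Z [j]] : exists Z : {ffun 'I_N -> I}, exists j : 'I_N,
    N%:R * (\sum_(i | weakh H d (x \o Z) (y \o Z) j (x i) != y i) v cs i)
    <= (2 * d)%:R * \sum_i v cs i.
  apply: (weak_learner vcH Hh) => // i vi; apply: hw.
  rewrite lt_neqAle w0 andbT eq_sym; apply: contraTneq vi => wi.
  by rewrite /v wi !mul0r ltxx.
set e := \sum_(i | _) _; set W := \sum_i v cs i => le_e.
have e4 : 4 * e <= W.
  have W0 : 0 <= W by apply: sumr_ge0.
  have : N%:R * (4 * e) <= N%:R * W.
    apply: (@le_trans _ _ ((8 * d)%:R * W)); last by rewrite ler_wpM2r // ler_nat.
    have -> : (8 * d)%:R = 4 * (2 * d)%:R :> R by rewrite -natrM mulnA.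
    by rewrite mulrCA -mulrA ler_wpM2l.
  by rewrite ler_pM2l // ltr0n.
exists [tuple of (Z, j) :: cs].
have -> : \sum_i v [tuple of (Z, j) :: cs] i = 2 * e + (W - e) / 2.
  have -> : W - e = \sum_(i | ~~ (weakh H d (x \o Z) (y \o Z) j (x i) != y i)) v cs i.
    by rewrite /W (bigID (fun i => weakh H d (x \o Z) (y \o Z) j (x i) != y i)) /= -/e addrAC subrr add0r.
  rewrite (bigID (fun i => weakh H d (x \o Z) (y \o Z) j (x i) != y i)) /=.
  rewrite /e mulr_sumr mulr_suml; congr (_ + _); apply: eq_bigr => i wi.
    rewrite /v /nwrong /= {1}/decode /= wi add1n mulnS exprD expr2 (exprS _ (size cs)) invfM.
    by move: (2 ^+ (2 * _)) (2 ^+ size cs)^-1 => a b; field.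
  rewrite /v /nwrong /= {1}/decode /= (negbTE wi) add0n (exprS _ (size cs)) invfM.
  by move: (2 ^+ (2 * _)) (2 ^+ size cs)^-1 => a b; field.
rewrite exprS -mulrA; apply: le_trans (_ : 7 / 8 * W <= _); last by rewrite ler_pM2l //; lra.
lra.
Qed.

(** With [d = 0] the weak learner makes no weighted error, so one voter trained on one point is
    enough. The case is kept apart because for [m = 0] the claimed bound leaves no room for a
    squared logarithm. *)
Lemma boosting0 (i0 : I) : d = 0%N ->
  exists cs : 1.-tuple (weak_code 1), \sum_(i | vote cs (x i) != y i) w i <= 0.
Proof.
move=> d0.
have [Z [j]] := weak_learner vcH Hh w0 hw i0 (isT : (0 < 1)%N).
rewrite d0 muln0 mul0r mul1r => le; exists [tuple (Z, j)].
apply: le_trans le; rewrite le_eqVlt; apply/orP; left; apply/eqP; apply: eq_bigl => i.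
by rewrite /vote /= /decode /= d0; case: weakh.
Qed.

Definition boost_params (N T : nat) (gam : R) :=
  (d = 0%N /\ N = 1%N /\ T = 1%N /\ 0 <= gam) \/
  [/\ (0 < N)%N, (8 * d <= N)%N & (7 / 8) ^+ T <= gam].

Lemma boosted_vote N T gam (i0 : I) : boost_params N T gam ->
  exists cs : T.-tuple (weak_code N),
    \sum_(i | vote cs (x i) != y i) w i <= gam * \sum_i w i.
Proof.
have W0 : 0 <= \sum_i w i by apply: sumr_ge0.
case=> [[d0 [-> [-> g0]]]|[N0 dN gT]].
  have [cs le] := boosting0 i0 d0; exists cs; apply: le_trans le _.
  by rewrite mulr_ge0.
have [cs le] := boosting T i0 N0 dN; exists cs; apply: le_trans le _.
by rewrite ler_wpM2r.
Qed.

End Boosting.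

(** * Signed sums and expectations under a countable distribution *)

Section Esum.
Variable R : realType.
Local Open Scope ereal_scope.

Lemma esumZ (T : choiceType) (D : set T) (c : R) (u : T -> \bar R) :
  (0 < c)%R -> (forall i, 0 <= u i) ->
  \esum_(i in D) (c%:E * u i) = c%:E * \esum_(i in D) u i.
Proof.
move=> c0 u0.
have le (k : R) (v : T -> \bar R) : (0 < k)%R -> (forall i, 0 <= v i) ->
    \esum_(i in D) (k%:E * v i) <= k%:E * \esum_(i in D) v i.
  move=> k0 v0; apply: ge_ereal_sup => /= _ [X XD <-].
  rewrite -ge0_mule_fsumr //; apply: lee_wpmul2l; first by rewrite lee_fin ltW.
  by apply: ereal_sup_ubound; exists X.
apply/eqP; rewrite eq_le le //=.
have cu i : u i = c^-1%:E * (c%:E * u i) by rewrite muleA -EFinM mulVf ?gt_eqF // mul1e.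
rewrite (eq_esum (fun i _ => cu i)).
apply: (@le_trans _ _ (c%:E * (c^-1%:E * \esum_(i in D) (c%:E * u i)))).
  apply: lee_wpmul2l; first by rewrite lee_fin ltW.
  by apply: le => [|i]; rewrite ?invr_gt0 // mule_ge0 // lee_fin ltW.
by rewrite muleA -EFinM mulfV ?gt_eqF // mul1e.
Qed.

(** Any splitting of [u] into nonnegative summable parts can replace the positive and negative parts
    in [ssum], since [P + sy = N + sx] with all four finite. *)
Lemma ssum_diff (T : choiceType) (D : set T) (u x y : T -> R) (sx sy : R) :
  (forall i, 0 <= x i)%R -> (forall i, 0 <= y i)%R -> (forall i, u i = x i - y i)%R ->
  \esum_(i in D) (x i)%:E = sx%:E -> \esum_(i in D) (y i)%:E = sy%:E ->
  ssum D (fun i => (u i)%:E) = (sx - sy)%:E.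
Proof.
move=> x0 y0 uE Ex Ey; rewrite /ssum.
have pE i : maxe (u i)%:E 0 = (Num.max (u i) 0)%:E by rewrite EFin_max.
have nE i : maxe (- (u i)%:E) 0 = (Num.max (- u i) 0)%:E by rewrite EFin_max.
under eq_esum do rewrite pE; under [X in _ - X]eq_esum do rewrite nE.
set P := \esum_(i in D) _; set N := \esum_(i in D) _.
have m0 (z : R) : (0 <= Num.max z 0)%R by rewrite le_max lexx orbT.
have P0 : 0 <= P by apply: esum_ge0 => i _; rewrite lee_fin.
have N0 : 0 <= N by apply: esum_ge0 => i _; rewrite lee_fin.
have Px : P <= sx%:E.
  by rewrite -Ex; apply: le_esum => i _; rewrite lee_fin ge_max x0 uE lerBlDr lerDl y0.
have Ny : N <= sy%:E.
  by rewrite -Ey; apply: le_esum => i _; rewrite lee_fin ge_max y0 uE opprB lerBlDr lerDl x0.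
have : P + sy%:E = N + sx%:E.
  rewrite -Ex -Ey -!esumD; do ?[by move=> i _; rewrite lee_fin].
  apply: eq_esum => i _; rewrite -!EFinD; congr _%:E; rewrite uE !maxEle.
  by case: ifP => h1; case: ifP => h2; move: (x0 i) (y0 i) h1 h2; lra.
have Pf : P \is a fin_num.
  by rewrite ge0_fin_numE // (le_lt_trans Px) // ltry.
have Nf : N \is a fin_num.
  by rewrite ge0_fin_numE // (le_lt_trans Ny) // ltry.
move: Pf Nf => /fineK <- /fineK <-; rewrite -!EFinD => -[e].
by congr _%:E; lra.
Qed.

End Esum.

Section Mean.
Variables (R : realType) (p : nat -> R).
Hypotheses (p0 : forall i, 0 <= p i) (p1 : \esum_(i in [set: nat]) (p i)%:E = 1%E).
Implicit Types g : nat -> R.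

Definition mean g : R := fine (ssum [set: nat] (fun i => (p i * g i)%:E)).

Lemma esum_fin g c : (forall i, 0 <= g i <= c) ->
  \esum_(i in [set: nat]) (p i * g i)%:E = (fine (\esum_(i in [set: nat]) (p i * g i)%:E))%:E.
Proof.
move=> gc; rewrite fineK //.
have c0 : 0 <= c by have /andP[] := gc 0%N; exact: le_trans.
rewrite ge0_fin_numE; last first.
  by apply: esum_ge0 => i _; rewrite lee_fin mulr_ge0 //; case/andP: (gc i).
apply: (@le_lt_trans _ _ (\esum_(i in [set: nat]) ((c + 1)%:E * (p i)%:E)%E)).
  apply: le_esum => i _; rewrite lee_fin mulrC ler_wpM2r //.
  by case/andP: (gc i) => _ /le_trans; apply; rewrite lerDl.
by rewrite esumZ ?p1 ?mule1 ?ltry // ltr_wpDl.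
Qed.

Lemma esum_const c : 0 <= c -> \esum_(i in [set: nat]) (p i * c)%:E = c%:E.
Proof.
rewrite le_eqVlt => /predU1P[<-|c0].
  by rewrite esum1 // => i _; rewrite mulr0.
under eq_esum do rewrite mulrC EFinM.
by rewrite esumZ ?p1 ?mule1.
Qed.

(** Adding the constant [c] makes the integrand nonnegative; linearity of [mean] then reduces to
    that of [\esum]. *)
Lemma ssum_mean_shift g c : (forall i, `|g i| <= c) ->
  ssum [set: nat] (fun i => (p i * g i)%:E) =
  (fine (\esum_(i in [set: nat]) (p i * (g i + c))%:E) - c)%:E.
Proof.
move=> gc.
have c0 : 0 <= c by apply: le_trans (gc 0%N).
have gc' i : 0 <= g i + c <= c + c by have := gc i; rewrite ler_norml; lra.
apply: (@ssum_diff _ _ _ _ (fun i => p i * (g i + c)) (fun i => p i * c)).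
- by move=> i; rewrite mulr_ge0 //; case/andP: (gc' i).
- by move=> i; rewrite mulr_ge0.
- by move=> i; ring.
- exact: esum_fin gc'.
- exact: esum_const.
Qed.

Lemma ssum_mean g c : (forall i, `|g i| <= c) ->
  ssum [set: nat] (fun i => (p i * g i)%:E) = (mean g)%:E.
Proof. by move=> gc; rewrite /mean (ssum_mean_shift gc). Qed.

Lemma mean_shift g c : (forall i, `|g i| <= c) ->
  mean g = fine (\esum_(i in [set: nat]) (p i * (g i + c))%:E) - c.
Proof. by move=> gc; rewrite /mean (ssum_mean_shift gc). Qed.

Lemma mean_nneg g c : (forall i, 0 <= g i <= c) ->
  \esum_(i in [set: nat]) (p i * g i)%:E = (mean g)%:E.
Proof.
move=> gc; rewrite (esum_fin gc) /mean; congr _%:E.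
have e0 : \esum_(i in [set: nat]) (0 : R)%:E = 0%:E by rewrite esum1.
rewrite (@ssum_diff _ _ _ _ (fun i => p i * g i) (fun i => 0) _ _ _ _ _ (esum_fin gc) e0) //.
- by rewrite subr0.
- by move=> i; rewrite mulr_ge0 //; case/andP: (gc i).
- by move=> i; rewrite subr0.
Qed.

Lemma meanD g1 g2 c1 c2 : (forall i, `|g1 i| <= c1) -> (forall i, `|g2 i| <= c2) ->
  mean (fun i => g1 i + g2 i) = mean g1 + mean g2.
Proof.
move=> h1 h2; rewrite (mean_shift h1) (mean_shift h2) (@mean_shift _ (c1 + c2)); last first.
  by move=> i; apply: le_trans (ler_normD _ _) (lerD _ _).
have b1 i : 0 <= g1 i + c1 <= c1 + c1 by have := h1 i; rewrite ler_norml; lra.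
have b2 i : 0 <= g2 i + c2 <= c2 + c2 by have := h2 i; rewrite ler_norml; lra.
have -> : \esum_(i in [set: nat]) (p i * (g1 i + g2 i + (c1 + c2)))%:E =
   (\esum_(i in [set: nat]) (p i * (g1 i + c1))%:E + \esum_(i in [set: nat]) (p i * (g2 i + c2))%:E)%E.
  rewrite -esumD; first by apply: eq_esum => i _; rewrite -EFinD; congr _%:E; ring.
    by move=> i _; rewrite lee_fin mulr_ge0 //; case/andP: (b1 i).
  by move=> i _; rewrite lee_fin mulr_ge0 //; case/andP: (b2 i).
rewrite (esum_fin b1) (esum_fin b2) -EFinD /=; ring.
Qed.

Lemma mean_cst c : mean (fun=> c) = c.
Proof.
rewrite (@mean_shift _ `|c|) // esum_const /=; first by ring.
by have := ler_norm (- c); rewrite normrN; lra.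
Qed.

Lemma meanN g c : (forall i, `|g i| <= c) -> mean (fun i => - g i) = - mean g.
Proof.
move=> gc; apply/eqP; rewrite -addr_eq0 -(@meanD _ _ c c) //; last by move=> i; rewrite normrN.
by under eq_fun do rewrite addNr; rewrite mean_cst.
Qed.

Lemma meanZ k g c : 0 < k -> (forall i, 0 <= g i <= c) -> mean (fun i => k * g i) = k * mean g.
Proof.
move=> k0 gc; apply: EFin_inj; rewrite EFinM -(mean_nneg gc) -(@mean_nneg _ (k * c)); last first.
  by move=> i; case/andP: (gc i) => ? ?; rewrite mulr_ge0 ?ler_wpM2l // ltW.
rewrite -esumZ //; first by apply: eq_esum => i _; rewrite mulrCA.
by move=> i; rewrite lee_fin mulr_ge0 //; case/andP: (gc i).
Qed.

Lemma mean_sum (J : finType) (g : J -> nat -> R) c : (forall j i, `|g j i| <= c) ->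
  mean (fun i => \sum_j g j i) = \sum_j mean (g j).
Proof.
move=> gc; elim: (index_enum J) => [|j s IH].
  by under eq_fun do rewrite big_nil; rewrite big_nil mean_cst.
under eq_fun do rewrite big_cons; rewrite big_cons -IH.
apply: (@meanD _ _ c (\sum_(j <- s) c)) => // i.
by apply: le_trans (ler_norm_sum _ _ _) _; apply: ler_sum.
Qed.

(* exp(lam (e - g)) is dominated by its quadratic Taylor bound, whose linear part has mean <= 0 *)
Lemma mgf_bound g e lam : 0 < lam <= 1 / 9 -> 0 <= e <= 5 / 2 ->
  (forall i, `|g i| <= 2) -> e <= mean g ->
  (\esum_(i in [set: nat]) (p i * expR (lam * (e - g i)))%:E <= (1 + 41 * lam ^+ 2)%:E)%E.
Proof.
move=> lam9 e2 g2 eg.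
have gb i : - 2 <= g i <= 2 by rewrite -ler_norml.
have g2b i : 0 <= 2 - g i <= 4 by have := gb i; lra.
pose q i := (1 + 41 * lam ^+ 2 + lam * (e - 2)) + lam * (2 - g i).
have le i : expR (lam * (e - g i)) <= q i.
  (* The hypotheses give [|e - g i| <= 9 / 2]. Hence [u <= 1 / 2] when [lam <= 1 / 9], and 41/2 is a
     rounding of 81/4. *)
  set u := lam * (e - g i).
  have u1 : u <= 1 / 2 by rewrite /u; have := gb i; nra.
  have uq : u ^+ 2 <= 41 / 2 * lam ^+ 2.
    rewrite /u exprMn mulrC ler_wpM2r ?sqr_ge0 //; have := gb i; nra.
  (* This follows from [expR (- u) >= 1 - u] and [(1 - u) * (1 + u + 2 * u ^+ 2) = 1 + u ^+ 2 * (1 -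
     2 * u)]. *)
  have eu : expR u <= 1 + u + 2 * u ^+ 2.
    have q0 : 0 < 1 + u + 2 * u ^+ 2 by have := sqr_ge0 (u + 1 / 4); lra.
    rewrite -[u in expR u]opprK expRN invf_ple ?posrE ?expR_gt0 //.
    apply: le_trans (expR_ge1Dx _); rewrite -[X in X <= _]div1r ler_pdivrMr //.
    have h : 0 <= u ^+ 2 * (1 - 2 * u) by rewrite mulr_ge0 ?sqr_ge0 //; lra.
    lra.
  by rewrite /q /u in uq eu *; lra.
have qb i : 0 <= q i <= `|1 + 41 * lam ^+ 2 + lam * (e - 2)| + 4 * lam.
  rewrite (le_trans (expR_ge0 _) (le i)) /= /q lerD ?ler_norm //.
  by rewrite mulrC ler_wpM2r //; case/andP: (g2b i) => // *; lra.
apply: (@le_trans _ _ (\esum_(i in [set: nat]) (p i * q i)%:E)%E).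
  by apply: le_esum => i _; rewrite lee_fin ler_wpM2l.
have l0 : 0 < lam by lra.
rewrite (mean_nneg qb) lee_fin /q (@meanD _ _ `|1 + 41 * lam ^+ 2 + lam * (e - 2)| (4 * lam)) //.
  rewrite mean_cst (meanZ l0 g2b) (@meanD _ _ 2 2) //; last by move=> i; rewrite normrN.
    by rewrite mean_cst (meanN g2); nra.
  by move=> i; rewrite ger0_norm.
by move=> i; have /andP[a b] := g2b i; rewrite ger0_norm ?mulr_ge0 ?(ltW l0) // mulrC ler_wpM2r // ltW.
Qed.

End Mean.

(** * Product measures on samples *)

Section Product.
Variables (R : realType) (p : nat -> R).
Hypotheses (p0 : forall i, 0 <= p i) (p1 : \esum_(i in [set: nat]) (p i)%:E = 1%E).
Variable n : nat.

Definition tset n (t : n.-tuple nat) (i : 'I_n) (j : nat) : n.-tuple nat :=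
  [tuple replace (tnth t) i j k | k < n].

Lemma tnth_tset (t : n.-tuple nat) i j k :
  tnth (tset t i j) k = if k == i then j else tnth t k.
Proof. by rewrite tnth_mktuple. Qed.

Lemma tsetK (t : n.-tuple nat) i j : tset (tset t i j) i (tnth t i) = t.
Proof. by apply: eq_from_tnth => k; rewrite !tnth_tset; case: eqP => [->|]. Qed.

Definition tprob n (t : n.-tuple nat) : R := \prod_(k < n) p (tnth t k).

Lemma tprob_ge0 m (t : m.-tuple nat) : 0 <= tprob t.
Proof. exact: prodr_ge0. Qed.

Lemma tprob_tset (t : n.-tuple nat) i j : tprob (tset t i j) * p (tnth t i) = tprob t * p j.
Proof.
rewrite /tprob (bigD1 i) //= [in RHS](bigD1 i) //= tnth_tset eqxx.
rewrite (eq_bigr (fun k => p (tnth t k))) => [|k /negbTE ki]; last by rewrite tnth_tset ki.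
ring.
Qed.

Local Open Scope ereal_scope.

Lemma setX_dep (T U : Type) : [set: T * U] = [set: T] `*`` (fun=> [set: U]).
Proof. by apply/seteqP; split. Qed.

Lemma esum_tprob m : \esum_(t in [set: m.-tuple nat]) (tprob t)%:E = 1.
Proof.
elim: m => [|m IH].
  have -> : [set: 0.-tuple nat] = [set [tuple]].
    by apply/seteqP; split => // t _; rewrite [t]tuple0.
  by rewrite esum_set1 /tprob ?big_ord0.
pose e (jt : nat * m.-tuple nat) : m.+1.-tuple nat := [tuple of jt.1 :: jt.2].
have eb : set_bij [set: nat * m.-tuple nat] [set: m.+1.-tuple nat] e.
  split=> //.
    move=> [j t] [j' t'] _ _ /(congr1 val) /= [-> tt']; congr (_, _); exact: val_inj.
  by move=> t _; exists (thead t, [tuple of behead t]) => //; rewrite [RHS]tuple_eta.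
rewrite (@reindex_esum R _ _ _ _ e _ eb).
rewrite setX_dep.
have tE (jt : nat * m.-tuple nat) : (tprob (e jt))%:E = (p jt.1 * tprob jt.2)%:E.
  rewrite /tprob big_ord_recl; congr (_ * _)%:E; apply: eq_bigr => k _.
  by rewrite tnthS.
under eq_esum do rewrite tE.
rewrite -(@esum_esum _ _ _ _ _ (fun j t => (p j * tprob t)%:E)); last first.
  by move=> j t _ _; rewrite lee_fin mulr_ge0 // tprob_ge0.
rewrite -[RHS]p1; apply: eq_esum => j _.
have [->|pj] := eqVneq (p j) 0%R; first by rewrite esum1 // => t _; rewrite mul0r.
under eq_esum do rewrite EFinM.
rewrite esumZ ?IH ?mule1 //; first by rewrite lt_neqAle eq_sym pj p0.
by move=> t; rewrite lee_fin tprob_ge0.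
Qed.

Lemma esum_resample (F : n.-tuple nat -> R) i : (forall t, 0 <= F t)%R ->
  \esum_(t in [set: n.-tuple nat]) (tprob t * F t)%:E =
  \esum_(t in [set: n.-tuple nat]) \esum_(j in [set: nat]) (tprob t * (p j * F (tset t i j)))%:E.
Proof.
move=> F0.
pose phi (tj : n.-tuple nat * nat) := (tset tj.1 i tj.2, tnth tj.1 i).
have phib : set_bij [set: n.-tuple nat * nat] [set: n.-tuple nat * nat] phi.
  rewrite setTT_bijective; apply: inv_bij => -[t j].
  by rewrite /phi /= tsetK tnth_tset eqxx.
transitivity (\esum_(tj in [set: n.-tuple nat * nat]) (tprob tj.1 * p tj.2 * F tj.1)%:E).
  rewrite setX_dep -(@esum_esum _ _ _ _ _ (fun t j => (tprob t * p j * F t)%:E)); last first.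
    by move=> t j _ _; rewrite lee_fin !mulr_ge0 // tprob_ge0.
  apply: eq_esum => t _.
  have tF0 : (0 <= tprob t * F t)%R by rewrite mulr_ge0 // tprob_ge0.
  rewrite -(esum_const p0 p1 tF0); apply: eq_esum => j _; congr _%:E; ring.
rewrite (@reindex_esum R _ _ _ _ phi _ phib) setX_dep.
rewrite (@esum_esum _ _ _ _ _ (fun t j => (tprob t * (p j * F (tset t i j)))%:E)); last first.
  by move=> t j _ _; rewrite lee_fin !mulr_ge0 // tprob_ge0.
by apply: eq_esum => -[t j] _ /=; rewrite tprob_tset mulrA.
Qed.

Lemma esum_prod_le (D : seq 'I_n) (phi : n.-tuple nat -> nat -> R) (rho : R) :
  uniq D -> (forall t j, 0 <= phi t j)%R ->
  (forall t i j, i \in D -> phi (tset t i j) = phi t) ->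
  (forall t, \esum_(j in [set: nat]) (p j * phi t j)%:E <= rho%:E) ->
  \esum_(t in [set: n.-tuple nat]) (tprob t * \prod_(i <- D) phi t (tnth t i))%:E
  <= (rho ^+ size D)%:E.
Proof.
move=> uD phi0 phiD phir.
have rho0 : (0 <= rho)%R.
  rewrite -lee_fin; apply: le_trans (phir [tuple 0%N | i < n]).
  by apply: esum_ge0 => j _; rewrite lee_fin mulr_ge0.
elim: D uD phiD => [_ _|i D IH /= /andP[iD uD] phiD].
  by under eq_esum do rewrite big_nil mulr1; rewrite esum_tprob.
rewrite (@esum_resample (fun t => (\prod_(k <- i :: D) phi t (tnth t k))%R) i); last first.
  by move=> t; apply: prodr_ge0.
have D0 t : (0 <= tprob t * \prod_(k <- D) phi t (tnth t k))%R.
  by rewrite mulr_ge0 ?tprob_ge0 //; apply: prodr_ge0.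
have IH' := IH uD (fun t k j kD => phiD t k j (@mem_behead _ (i :: D) _ kD)).
apply: (@le_trans _ _ (\esum_(t in [set: n.-tuple nat])
   ((tprob t * \prod_(k <- D) phi t (tnth t k))%:E * rho%:E))); last first.
  have [->|r0] := eqVneq rho 0%R; first by rewrite esum1 ?lee_fin ?exprn_ge0 // => *; rewrite mule0.
  under eq_esum do rewrite muleC.
  rewrite esumZ //; first by rewrite exprS EFinM lee_wpmul2l.
  by rewrite lt_neqAle eq_sym r0 rho0.
apply: le_esum => t _.
set A := (tprob t * _)%R.
have AE j : (tprob t * (p j * \prod_(k <- i :: D) phi (tset t i j) (tnth (tset t i j) k)) =
    A * (p j * phi t j))%R.
  rewrite phiD ?mem_head // big_cons tnth_tset eqxx /A.
  have -> : (\prod_(k <- D) phi t (tnth (tset t i j) k) = \prod_(k <- D) phi t (tnth t k))%R.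
    apply: eq_big_seq => k kD; rewrite tnth_tset; case: eqP => // ki; by rewrite -ki kD in iD.
  ring.
under eq_esum do rewrite AE.
have [->|A0] := eqVneq A 0%R; first by rewrite mul0e esum1 // => j _; rewrite mul0r.
under eq_esum do rewrite EFinM.
rewrite esumZ; first by apply: lee_wpmul2l => //; rewrite lee_fin ltW // lt_neqAle eq_sym A0 D0.
  by rewrite lt_neqAle eq_sym A0 D0.
by move=> j; rewrite lee_fin mulr_ge0.
Qed.

End Product.

(** * Realizable labels and violated constraints *)

Section Population.
Variables (R : realType) (X : Type) (p : nat -> R) (a : nat -> X * R).
Hypothesis dd : is_ddist p a.

Let p0 i : 0 <= p i. Proof. by have [] := dd. Qed.
Let p1 : \esum_(i in [set: nat]) (p i)%:E = 1%E. Proof. by have [_ []] := dd. Qed.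
Let a1 i : -1 <= (a i).2 <= 1. Proof. by have [_ [_]] := dd. Qed.

Definition sgb (s : bool) : R := if s then 1 else -1.

Lemma norm_sgb s : `|sgb s| = 1.
Proof. by case: s; rewrite /sgb ?normrN normr1. Qed.

(** For [r = 1] or [r = -1] and [|y| <= 1] the quantity [- r * (y - r) = 1 - r * y] is nonnegative.
    Its mean over the atoms at a given point is 0, so it vanishes at every atom of positive mass. *)
Lemma realizable_label (S : set (X -> option R)) : binary_class S -> realizable S p a ->
  exists2 s, S s & forall i, 0 < p i -> s (a i).1 = Some (a i).2 /\ (a i).2 = sgb (0 < (a i).2).
Proof.
move=> bin [s [Ss [sN sE]]]; exists s => // i pi.
suff sy : s (a i).1 = Some (a i).2.
  split=> //; case: (bin s (a i).1 Ss) => [|[|]]; rewrite sy // => -[->].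
    by rewrite /sgb ltr01.
  by rewrite /sgb oppr_gt0 ltr10.
have [r sr r1] : exists2 r, s (a i).1 = Some r & r = 1 \/ r = -1.
  case: (bin s (a i).1 Ss) => [sn|[->|->]]; [by have := sN _ pi|exists 1|exists (-1)] => //.
    by left.
  by right.
rewrite sr; congr Some.
pose g j := ((a j).2 - r) * \1_[set (a i).1] (a j).1.
have gb j : `|g j| <= 2.
  rewrite /g indicE normrM; case: (_ \in _); rewrite ?normr0 ?mulr0 // normr1 mulr1.
  by rewrite ler_norml; have := a1 j; case: r1 => ->; lra.
have mg : mean p g = 0.
  by apply: EFin_inj; rewrite -(ssum_mean p0 p1 gb); exact: (sE _ _ sr).
have rg j : 0 <= - r * g j <= 2.
  rewrite /g indicE; case: (_ \in _); rewrite ?mulr0 ?lexx //= mulr1.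
  by have := a1 j; case: r1 => ->; lra.
have mrg : mean p (fun j => - r * g j) = 0.
  case: r1 => r1.
    rewrite -[RHS]oppr0 -mg -(meanN p0 p1 gb); congr mean; apply/funext => j.
    by rewrite {1}r1 mulN1r.
  by rewrite -mg; congr mean; apply/funext => j; rewrite {1}r1 opprK mul1r.
have : (((p i * (- r * g i))%:E : \bar R) <= 0)%E.
  rewrite -[X in (_ <= X)%E]/((0 : R)%:E) -mrg -(mean_nneg p0 p1 rg); apply: esum_ge.
  by exists [set i]; [split|rewrite fsbig_set1].
rewrite lee_fin pmulr_rle0 // /g indicE mem_set //= mulr1.
by have := a1 i; case: r1 => ->; lra.
Qed.

Lemma gprod_norm u (b : option R) : (forall r, b = Some r -> -1 <= r <= 1) -> `|gprod u b| <= `|u|.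
Proof.
case: b => [r|] /= br; last by rewrite normrN normr_id.
by rewrite normrM ler_piMr //; have := br r erefl; rewrite ler_norml.
Qed.

Lemma gprod0 (b : option R) : gprod 0 b = 0.
Proof. by case: b => [r|] /=; rewrite ?mul0r // normr0 oppr0. Qed.

Variable B : set (X -> option R).
Hypothesis rB : real_class B.
Variable f : X -> R.
Hypothesis f1 : forall x, -1 <= f x <= 1.

(** Common form of both errors: [sg] is a constant sign for multiaccuracy and a function of the
    level of [f] for multicalibration. *)
Definition test_fun (b : X -> option R) (sg : X -> R) (j : nat) : R :=
  gprod ((f (a j).1 - (a j).2) * sg (a j).1) (b (a j).1).

Lemma test_fun_norm b sg j : B b -> (forall x, `|sg x| <= 1) -> `|test_fun b sg j| <= 2.
Proof.
move=> Bb sg1; apply: le_trans (gprod_norm _ _) _; first by move=> r; exact: rB.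
rewrite normrM; apply: le_trans (ler_piMr _ (sg1 _)) _ => //.
by rewrite ler_norml; have := f1 (a j).1; have := a1 j; lra.
Qed.

Lemma MA_violation eps : ~ (MA_error p a B f <= eps%:E)%E ->
  exists b, exists s : bool, B b /\ eps < mean p (test_fun b (fun=> sgb s)).
Proof.
move=> /negP; rewrite -ltNge => /ereal_sup_gt[_ [b [s [Bb [s1 ->]]]]] lt.
have [t st] : exists t, s = sgb t by case: s1 => ->; [exists true|exists false].
exists b, t; split=> //; move: lt.
have tn j : `|test_fun b (fun=> sgb t) j| <= 2 by apply: test_fun_norm => // x; rewrite norm_sgb.
by rewrite -lte_fin -(ssum_mean p0 p1 tn) st.
Qed.

(** Choosing for each level the sign that attains the inner supremum merges the sum over levels into
    a single correlation with the sign function [s (k x)]. *)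
Lemma MC_violation eps M (lev : 'I_M -> R) (k : X -> 'I_M) :
  injective lev -> (forall x, f x = lev (k x)) ->
  ~ (MC_error p a B f <= eps%:E)%E ->
  exists b, exists s : {ffun 'I_M -> bool}, B b /\
    eps < mean p (test_fun b (fun x => sgb (s (k x)))).
Proof.
move=> levI fk /negP; rewrite -ltNge => /ereal_sup_gt[_ [b [Bb ->]]] lt.
pose g v s j := gprod ((f (a j).1 - (a j).2) * \1_[set v] (f (a j).1) * sgb s) (b (a j).1).
have gE v s : g v s = test_fun b (fun x => \1_[set v] (f x) * sgb s).
  by apply/funext => j; rewrite /g /test_fun mulrA.
have gn v s j : `|g v s j| <= 2.
  rewrite gE; apply: test_fun_norm => // x.
  by rewrite normrM norm_sgb mulr1 indicE; case: (_ \in _); rewrite ?normr0 ?normr1.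
pose U v := Num.max (mean p (g v true)) (mean p (g v false)).
have UE v : maxe (Ex p a (fun xy => gprod ((f xy.1 - xy.2) * \1_[set v] (f xy.1)) (b xy.1)))
      (Ex p a (fun xy => gprod ((f xy.1 - xy.2) * \1_[set v] (f xy.1) * -1) (b xy.1))) = (U v)%:E.
  rewrite /U EFin_max -(ssum_mean p0 p1 (gn v true)) -(ssum_mean p0 p1 (gn v false)).
  by rewrite /Ex /g /sgb; congr maxe; congr ssum; apply/funext => j; rewrite mulr1.
(* Levels missed by [f] contribute 0, so the sum over [range f] can run over the whole grid. *)
have U0 v : ~ range f v -> U v = 0.
  move=> nv; have g0 s : mean p (g v s) = 0.
    rewrite -[RHS](mean_cst p0 p1 0); congr mean; apply/funext => j.
    rewrite /g indicE memNset ?mulr0 ?mul0r ?gprod0 // => fv; apply: nv.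
    by exists (a j).1.
  by rewrite /U !g0 maxxx.
have esumE (h : R -> R) : (forall v, 0 <= h v) -> (forall v, ~ range f v -> h v = 0) ->
    \esum_(v in range f) (h v)%:E = (\sum_i h (lev i))%:E.
  move=> h0 hn.
  have -> : \esum_(v in range f) (h v)%:E = \esum_(v in range lev) (h v)%:E.
    rewrite esum_mkcond [RHS]esum_mkcond; apply: eq_esum => v _.
    case: ifPn => [/set_mem [x _ <-]|/negP nv]; case: ifPn => // nr.
      by case/negP: nr; apply/mem_set; exists (k x).
    by rewrite hn // => rv; apply: nv; apply/mem_set.
  rewrite (@reindex_esum R _ _ [set: 'I_M] _ lev); last first.
    by split=> [i _|i j _ _ /levI|v [i _ <-]] //; exists i.
  rewrite esum_fset; [|exact: finite_finset|by move=> i _; rewrite lee_fin].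
  have -> : [set: 'I_M] = [set` index_enum 'I_M].
    by apply/seteqP; split=> // i _ /=; rewrite mem_index_enum.
  by rewrite -fsbig_seq ?index_enum_uniq // sumEFin.
have Usum : ssum (range f) (fun v => (U v)%:E) = (\sum_i U (lev i))%:E.
  rewrite (@ssum_diff _ _ _ _ (fun v => Num.max (U v) 0) (fun v => Num.max (- U v) 0)
     (\sum_i Num.max (U (lev i)) 0) (\sum_i Num.max (- U (lev i)) 0)).
  - congr _%:E; rewrite -sumrB; apply: eq_bigr => i _.
    by rewrite !maxEle; case: ifP; case: ifP; lra.
  - by move=> v; rewrite le_max lexx orbT.
  - by move=> v; rewrite le_max lexx orbT.
  - by move=> v; rewrite !maxEle; case: ifP; case: ifP; lra.
  - apply: (esumE (fun v => Num.max (U v) 0)) => v; first by rewrite le_max lexx orbT.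
    by move=> /U0 ->; rewrite maxxx.
  - apply: (esumE (fun v => Num.max (- U v) 0)) => v; first by rewrite le_max lexx orbT.
    by move=> /U0 ->; rewrite oppr0 maxxx.
pose s : {ffun 'I_M -> bool} := [ffun i => mean p (g (lev i) false) <= mean p (g (lev i) true)].
have sU i : U (lev i) = mean p (g (lev i) (s i)).
  by rewrite /U ffunE maxEge; case: ifP.
exists b, s; split=> //; rewrite -lte_fin; apply: lt_le_trans lt _.
under [X in ssum _ X]eq_fun do rewrite UE.
rewrite Usum lee_fin (eq_bigr _ (fun i _ => sU i)).
rewrite -(@mean_sum _ _ p0 p1 _ (fun i => g (lev i) (s i)) 2) // le_eqVlt; apply/orP; left.
apply/eqP; congr mean; apply/funext => j.
rewrite /test_fun (bigD1 (k (a j).1)) //= big1 ?addr0 => [|i ik].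
  by rewrite /g indicE mem_set ?mulr1 //= fk.
rewrite /g indicE memNset ?mulr0 ?mul0r ?gprod0 //= fk => /levI e.
by rewrite e eqxx in ik.
Qed.

End Population.

(** * Averaging threshold functions *)

Section Thresholds.
Variable R : realType.

Lemma count_below (q : nat) (z : R) : z <= q%:R -> z <= \sum_(l < q) (l%:R < z)%R%:R.
Proof.
elim: q => [|q IH] zq; first by rewrite big_ord0.
rewrite big_ord_recr /=; have [lt|ge] := ltP q%:R z; last by rewrite addr0; exact: IH.
apply: le_trans zq _; rewrite (eq_bigr (fun=> 1)) => [|l _].
  by rewrite sumr_const card_ord -natrD addn1.
by rewrite (lt_trans _ lt) // ltr_nat.
Qed.

Lemma count_above (q : nat) (z : R) : 0 <= z -> q%:R - 1 - z <= \sum_(l < q) (z < l%:R)%R%:R.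
Proof.
move=> z0; rewrite (reindex_inj rev_ord_inj) /=.
apply: le_trans (@count_below q _ _) _; first by lra.
apply: ler_sum => l _; rewrite ler_nat.
case: (ltP l%:R) => // h; suff -> : z < (rev_ord l)%:R by [].
by rewrite /= natrB ?ltn_ord // -natr1; lra.
Qed.

Definition theta (q : nat) (l : 'I_q) : R := 2 * l%:R / q%:R - 1.

(* Averaging the q threshold functions recovers b up to eta + 2/q. *)
Lemma thr_average (X : Type) (q : nat) (eta u : R) (b : X -> option R) x :
  (0 < q)%N -> 0 <= eta -> (forall r, b x = Some r -> -1 <= r <= 1) ->
  q%:R * gprod u (b x) - `|u| * (q%:R * eta + 2) <=
  \sum_(l < q) gprod u (thr (theta l) eta b x).
Proof.
move=> q0 eta0; have q0' : 0 < q%:R :> R by rewrite ltr0n.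
rewrite /thr; case: (b x) => [r /(_ r erefl) r1|_]; last first.
  rewrite /= sumr_const card_ord -[leRHS]mulr_natl gerBl mulr_ge0 // addr_ge0 // mulr_ge0 // ltW //.
have lq (l : 'I_q) : l%:R = q%:R * (l%:R / q%:R) :> R by rewrite mulrC mulfVK // gt_eqF.
have [u0|u0] := leP 0 u.
  rewrite ger0_norm //.
  (* The inequality [theta l + eta < r] means [l < z]. At least [z] indices satisfy it, so the signs
     sum to at least [2 * z - q = q * (r - eta)]. *)
  pose z := q%:R * ((r - eta + 1) / 2).
  have zq : z <= q%:R by rewrite /z ler_piMr //; lra.
  apply: (@le_trans _ _ (u * (2 * z - q%:R))); first by rewrite /z /=; lra.
  apply: (@le_trans _ _ (\sum_(l < q) u * (2 * (l%:R < z)%R%:R - 1))).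
    rewrite -mulr_sumr ler_wpM2l // sumrB -mulr_sumr sumr_const card_ord lerB //.
    by rewrite ler_pM2l //; exact: count_below.
  apply: ler_sum => l _; have -> : (l%:R < z) = (theta l + eta < r).
    by rewrite /z lq ltr_pM2l // /theta -mulrA; apply/idP/idP; lra.
  case: ifP => _ /=; first by lra.
  by case: ifP => _ /=; rewrite ?ger0_norm //; lra.
rewrite ltr0_norm //.
(* Here the indices above [z] count. There may be only [q - 1 - z] of them, and this off-by-one is
   the source of the [+ 2] in the statement. *)
pose z := q%:R * ((r + eta + 1) / 2).
have z0 : 0 <= z by rewrite /z mulr_ge0 //; lra.
apply: (@le_trans _ _ (- u * (2 * (q%:R - 1 - z) - q%:R))); first by rewrite /z /=; lra.
apply: (@le_trans _ _ (\sum_(l < q) - u * (2 * (z < l%:R)%R%:R - 1))).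
  rewrite -mulr_sumr ler_wpM2l //; first by lra.
  rewrite sumrB -mulr_sumr sumr_const card_ord lerB //.
  by rewrite ler_pM2l //; exact: count_above.
apply: ler_sum => l _; have -> : (z < l%:R) = (r < theta l - eta).
  by rewrite /z [l%:R]lq ltr_pM2l // /theta -mulrA; apply/idP/idP; lra.
case: ifP => [h1|_] /=; last first.
  by case: ifP => _ /=; rewrite ?ltr0_norm //; lra.
have -> : (r < theta l - eta) = false by apply/negP => h2; lra.
by rewrite mulr0; lra.
Qed.

End Thresholds.

(** * The grid of values and the squared loss *)

Section Levels.
Variables (R : realType) (q : nat).
Hypothesis q0 : (0 < q)%N.

Definition lev (i : 'I_(2 * q).+1) : R := i%:R / q%:R - 1.

Definition nudge (v : bool) (i : 'I_(2 * q).+1) : 'I_(2 * q).+1 :=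
  inord (if v then minn i.+1 (2 * q) else i.-1).

Let q0' : 0 < q%:R :> R. Proof. by rewrite ltr0n. Qed.

Lemma lev_inj : injective lev.
Proof.
move=> i j /addIr /(mulIf _) e; apply: val_inj; apply/eqP; rewrite -(eqr_nat R); apply/eqP.
by apply: e; rewrite invr_eq0 gt_eqF.
Qed.

Lemma lev_bound i : -1 <= lev i <= 1.
Proof.
have : i%:R / q%:R <= 2 :> R.
  by rewrite ler_pdivrMr // -natrM ler_nat -ltnS.
have : 0 <= i%:R / q%:R :> R by rewrite divr_ge0.
by rewrite /lev; lra.
Qed.

(** Expand the square of the residual changed by [1/q]. At an end of the grid the clamped move
    changes nothing: the residual is 0 if the move was towards the label, and the right side only
    grows if it was away from it. *)
Lemma nudge_potential v y i :
  (lev (nudge v i) - sgb R y) ^+ 2 <=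
  (lev i - sgb R y) ^+ 2 - 2 / q%:R * (if v == y then `|lev i - sgb R y| else - `|lev i - sgb R y|)
   + 1 / q%:R ^+ 2.
Proof.
have lb := lev_bound i.
set d := q%:R^-1; have d0 : 0 < d by rewrite invr_gt0.
have -> : 1 / q%:R ^+ 2 = d ^+ 2 by rewrite div1r exprVn.
have mv : if v then lev (nudge v i) = lev i + d \/ (lev i = 1 /\ lev (nudge v i) = 1)
   else lev (nudge v i) = lev i - d \/ (lev i = -1 /\ lev (nudge v i) = -1).
  have iq := ltn_ord i; rewrite /lev /nudge -/d; case: v; rewrite inordK; try lia.
    have [i2|i2] := ltnP i (2 * q).
      by left; rewrite (minn_idPl i2) -natr1; ring.
    have -> : i = (2 * q)%N :> nat by lia.
    right; rewrite (minn_idPr (leqnSn _)) natrM mulfK ?gt_eqF //; split; lra.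
  case: (nat_of_ord i) => [|j] /=; first by right; rewrite mul0r add0r.
  by left; rewrite -natr1; ring.
have := lev_bound (nudge v i); move: mv lb; move: (lev (nudge v i)) (lev i) => f' f.
case: v => mv fb fb'; case: y; rewrite /sgb /=.
- have -> : `|f - 1| = 1 - f by rewrite distrC ger0_norm //; lra.
  by case: mv => [->|[-> ->]]; have := sqr_ge0 d; nra.
- have -> : `|f - -1| = f + 1 by rewrite opprK ger0_norm //; lra.
  by case: mv => [->|[-> ->]]; have := sqr_ge0 d; nra.
- have -> : `|f - 1| = 1 - f by rewrite distrC ger0_norm //; lra.
  by case: mv => [->|[-> ->]]; have := sqr_ge0 d; nra.
- have -> : `|f - -1| = f + 1 by rewrite opprK ger0_norm //; lra.
  by case: mv => [->|[-> ->]]; have := sqr_ge0 d; nra.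
Qed.

End Levels.

(** * The agreement class *)

Section Agreement.
Variables (R : realType) (X : Type) (S B : set (X -> option R)) (eta : R) (m : nat).
Hypotheses (binS : binary_class S) (vcSB : VC_le S B eta m).

Definition sign_label (o : option R) : option bool := omap (fun r => 0 < r) o.

(** A residual [f x - y] is zero or opposite in sign to [y]. So [u == sig x (+) v] says that [h],
    taken with the sign [sig x], correlates nonnegatively with the residual. *)
Definition agree (sig : X -> bool) (s h : X -> option R) (x : X) : option bool :=
  match sign_label (s x), sign_label (h x) with
  | Some u, Some v => if u == sig x (+) v then Some u else None
  | _, _ => None
  end.

Definition agree_class (th : R) (sig : X -> bool) : set (X -> option bool) :=
  [set g | exists s b, [/\ S s, B b & g = agree sig s (thr th eta b)]].

(** On a shattered set [s] takes every labelling, and the threshold function takes every labelling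
    shifted by [sig]. As [sig] is fixed, both classes shatter the set. *)
Lemma agree_class_vc th sig : vcdim_le (agree_class th sig) m.
Proof.
move=> l ul sh; apply: (vcSB ul (theta := th)).
  move=> xi; have [g [s [b [Ss Bb ->]]] gx] := sh xi; exists s; split=> // x xl.
  have := gx x xl; rewrite /agree; have := binS x Ss.
  case: (s x) => [r|] //= [//|rE]; case: sign_label => [v|] //; case: eqP => // _ [<-].
  by case: rE => -[->]; rewrite ?ltr01 // oppr_gt0 ltr10.
move=> xi; have [g [s [b [Ss Bb ->]]] gx] := sh (fun x => sig x (+) xi x).
exists (thr th eta b); split; first by exists b.
move=> x xl; have := gx x xl; rewrite /agree /thr; case: (sign_label (s x)) => [u|] //.
case: (b x) => [r|] //=; case: ifP => _ /=.
  rewrite ltr01; case: eqP => // -> [].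
  by case: (sig x); case: (xi x).
case: ifP => _ //=; rewrite oppr_gt0 ltr10; case: eqP => // -> [].
by case: (sig x); case: (xi x).
Qed.

End Agreement.

(** * One round of improvement *)

Section Rounds.
Variables (R : realType) (X : Type) (S B : set (X -> option R)) (eta : R) (m : nat).
Hypotheses (binS : binary_class S) (vcSB : VC_le S B eta m) (rB : real_class B) (eta0 : 0 <= eta).
Variables (q : nat) (Sig : finType) (sgn : Sig -> 'I_(2 * q).+1 -> bool).
Hypothesis q0 : (0 < q)%N.
Variables (I : finType) (N T : nat).

(** A code stores signs, a threshold and indices into the sample; points and labels are looked up.
    It is a [finType] so that codes can be counted. *)
Definition round_code : finType := (Sig * 'I_q * T.-tuple ({ffun 'I_N -> I} * 'I_N))%type.

Section Sample.
Variables (x : I -> X) (y : I -> bool).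

Definition hyp (k : X -> 'I_(2 * q).+1) (c : round_code) : X -> bool :=
  vote (agree_class S B eta (theta R c.1.2) (fun u => sgn c.1.1 (k u))) m x y c.2.

Definition step (k : X -> 'I_(2 * q).+1) (c : round_code) (u : X) : 'I_(2 * q).+1 :=
  nudge (hyp k c u) (k u).

(** [None] is an idle round, so all runs can have the same length. The start [inord q] is the level
    of the value 0. *)
Definition run (cs : seq (option round_code)) : X -> 'I_(2 * q).+1 :=
  foldl (fun k oc => if oc is Some c then step k c else k) (fun=> inord q) cs.

Definition potential (k : X -> 'I_(2 * q).+1) : R :=
  \sum_i (lev R (k (x i)) - sgb R (y i)) ^+ 2.

Definition emp_corr (k : X -> 'I_(2 * q).+1) (s : Sig) (b : X -> option R) : R :=
  \sum_i gprod ((lev R (k (x i)) - sgb R (y i)) * sgb R (sgn s (k (x i)))) (b (x i)).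

Lemma improvement (s : X -> option R) k sg b (beta gam : R) :
  S s -> (forall i, s (x i) = Some (sgb R (y i))) -> B b ->
  0 < beta -> 16 <= q%:R * beta -> gam <= beta / 32 -> boost_params m N T gam ->
  eta <= 1 -> (0 < #|I|)%N ->
  #|I|%:R * (beta / 2 + 4 * eta) < emp_corr k sg b ->
  exists c, potential (step k c) <= potential k - #|I|%:R / q%:R ^+ 2.
Proof.
move=> Ss sx Bb beta0 qb gamb bp eta1 I0 viol.
have q0' : 0 < q%:R :> R by rewrite ltr0n.
have n0 : 0 < #|I|%:R :> R by rewrite ltr0n.
pose W i : R := `|lev R (k (x i)) - sgb R (y i)|.
have W0 i : 0 <= W i by exact: normr_ge0.
have W2 i : W i <= 2.
  by rewrite /W ler_norml /sgb; have := lev_bound R q0 (k (x i)); case: (y i); lra.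
pose u i : R := (lev R (k (x i)) - sgb R (y i)) * sgb R (sgn sg (k (x i))).
have uW i : `|u i| = W i by rewrite /u normrM norm_sgb mulr1.
(* Averaging over thresholds loses [2 * (q * eta + 2)] per point, as residuals are at most 2. From
   [q * (beta / 2 + 4 * eta)] at least [q * beta / 4] remains because [16 <= q * beta]. *)
have [l lP] : exists l : 'I_q,
    #|I|%:R * (beta / 4) <= \sum_i gprod (u i) (thr (theta R l) eta b (x i)).
  apply: contrapT => /forallNP nl.
  have up : \sum_(l < q) \sum_i gprod (u i) (thr (theta R l) eta b (x i)) <=
      q%:R * (#|I|%:R * (beta / 4)).
    rewrite mulr_natl -[X in _ *+ X]card_ord -sumr_const; apply: ler_sum => l _.
    by apply/ltW; rewrite ltNge; apply/negP/nl.
  have low : \sum_i (q%:R * gprod (u i) (b (x i)) - 2 * (q%:R * eta + 2)) <=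
      \sum_(l < q) \sum_i gprod (u i) (thr (theta R l) eta b (x i)).
    rewrite exchange_big; apply: ler_sum => i _.
    apply: le_trans (@thr_average R X q eta (u i) b (x i) q0 eta0 _); last first.
      by move=> r; exact: rB.
    by rewrite lerD2l lerN2 ler_wpM2r ?uW // addr_ge0 // mulr_ge0 // ltW.
  have := le_trans low up; rewrite sumrB -mulr_sumr sumr_const -[_ *+ _]mulr_natl -/(emp_corr k sg b).
  have v' := viol; rewrite -(ltr_pM2l q0') in v'.
  have qn : #|I|%:R * 16 <= #|I|%:R * (q%:R * beta) by rewrite ler_pM2l.
  have en : 0 <= q%:R * (#|I|%:R * eta) by rewrite !mulr_ge0 // ltW.
  lra.
pose sig v := sgn sg (k v); pose h := thr (theta R l) eta b.
pose A i := agree sig s h (x i) == Some (y i).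
(* Agreement points contribute [W i]; all others, including those where the threshold function is
   undefined, contribute [- W i]. *)
have gA i : gprod (u i) (h (x i)) = if A i then W i else - W i.
  have [WT WF] : (y i = true -> lev R (k (x i)) - sgb R true = - W i) /\
      (y i = false -> lev R (k (x i)) - sgb R false = W i).
    have lb := lev_bound R q0 (k (x i)).
    by rewrite /W; split=> ->; rewrite /sgb; [rewrite ler0_norm ?opprK|rewrite ger0_norm]; lra.
  rewrite /A /agree sx -/(sig (x i)) /h /thr.
  have -> : u i = (if y i then - W i else W i) * sgb R (sig (x i)).
    by rewrite /u; case: (y i) WT WF => WT WF; [rewrite WT|rewrite WF].
  have nW : `|(if y i then - W i else W i) * sgb R (sig (x i))| = W i.
    by rewrite normrM norm_sgb mulr1; case: (y i); rewrite ?normrN ger0_norm.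
  have sy : sign_label (Some (sgb R (y i))) = Some (y i).
    by rewrite /sign_label /= /sgb; case: (y i); rewrite ?ltr01 // oppr_gt0 ltr10.
  rewrite sy; case: (b (x i)) => [r|] /=; last by rewrite nW.
  case: (theta R l + eta < r) => /=; last case: (r < theta R l - eta) => /=; last by rewrite nW.
    by rewrite ltr01; case: (y i); case: (sig (x i)); rewrite /sgb /= ?mulr1 ?mulrN1 ?opprK.
  by rewrite oppr_gt0 ltr10; case: (y i); case: (sig (x i)); rewrite /sgb /= ?mulr1 ?mulrN1 ?mulr1 ?opprK.
pose w i := if A i then W i else 0.
have w0 i : 0 <= w i by rewrite /w; case: ifP.
have hw i : 0 < w i -> agree sig s h (x i) = Some (y i).
  by rewrite /w; case: ifP => [/eqP //|]; rewrite ltxx.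
have /card_gt0P[i0 _] := I0.
have Hh : agree_class S B eta (theta R l) sig (agree sig s h) by exists s, b.
have [cs csP] := boosted_vote (agree_class_vc binS vcSB (th := theta R l) (sig := sig)) Hh w0 hw i0 bp.
pose c : round_code := (sg, l, cs).
exists c.
pose ok i := hyp k c (x i) == y i.
have corr : #|I|%:R / q%:R <= \sum_i (if ok i then W i else - W i).
  have wn : \sum_i w i <= #|I|%:R * 2.
    rewrite mulr_natl -sumr_const; apply: ler_sum => i _.
    by rewrite /w; case: ifP.
  have ws0 : 0 <= \sum_i w i by apply: sumr_ge0.
  have gw : gam * \sum_i w i <= beta / 32 * (#|I|%:R * 2).
    by apply: le_trans (ler_wpM2r ws0 gamb) _; rewrite ler_wpM2l //; lra.
  (* Off the agreement set the vote cannot do worse than [- W i]; on it each error costs [2 * W i].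
     With [gam <= beta / 32] the total cost is at most [n * beta / 8], half of the correlation
     found. *)
  have sum_le : \sum_i gprod (u i) (h (x i)) - 2 * \sum_(i | ~~ ok i) w i <=
      \sum_i (if ok i then W i else - W i).
    rewrite [X in _ - 2 * X]big_mkcond mulr_sumr -sumrB; apply: ler_sum => i _.
    by rewrite gA /w; case: (ok i); case: (A i) => /=; have := W0 i; lra.
  have qn : #|I|%:R * 16 <= #|I|%:R * beta * q%:R by rewrite -mulrA ler_pM2l // mulrC.
  rewrite ler_pdivrMr //; apply: (@le_trans _ _ (#|I|%:R * beta / 8 * q%:R)).
    by have : 0 <= #|I|%:R :> R; rewrite ?ler0n //; lra.
  rewrite ler_wpM2r //; have := lP; rewrite -/h.
  have : \sum_(i | ~~ ok i) w i <= gam * \sum_i w i by exact: csP.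
  lra.
have drop : potential (step k c) <=
   \sum_i ((lev R (k (x i)) - sgb R (y i)) ^+ 2 - 2 / q%:R * (if ok i then W i else - W i)
      + 1 / q%:R ^+ 2).
  by apply: ler_sum => i _; exact: (@nudge_potential R q q0 (hyp k c (x i)) (y i) (k (x i))).
apply: (le_trans drop).
rewrite big_split sumrB /= -/(potential k) -mulr_sumr sumr_const.
rewrite -[_ *+ _]mulr_natl -addrA lerD2l.
have c2 : 2 / q%:R * (#|I|%:R / q%:R) <= 2 / q%:R * \sum_i (if ok i then W i else - W i).
  by rewrite ler_wpM2l // divr_ge0.
move: c2; have -> : q%:R ^- 2 = q%:R^-1 * q%:R^-1 :> R by rewrite expr2 invfM.
lra.
Qed.

End Sample.
End Rounds.

(** * Termination of the run and its dependence on the sample *)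

Section Run.
Variables (R : realType) (X : Type) (S B : set (X -> option R)) (eta : R) (m : nat).
Hypotheses (binS : binary_class S) (vcSB : VC_le S B eta m) (rB : real_class B).
Hypothesis eta1 : 0 <= eta <= 1.
Variables (q : nat) (Sig : finType) (sgn : Sig -> 'I_(2 * q).+1 -> bool).
Hypothesis q0 : (0 < q)%N.
Variables (I : finType) (N T : nat).

Local Notation code := (round_code q Sig I N T).
Local Notation run := (@run R X S B eta m q Sig sgn I N T).
Local Notation potential := (@potential R X q I).
Local Notation emp_corr := (@emp_corr R X q Sig sgn I).

Definition no_violation x y (thresh : R) (k : X -> 'I_(2 * q).+1) :=
  forall b sg, B b -> emp_corr x y k sg b <= thresh.

Lemma potential_ge0 x y k : 0 <= potential x y k.
Proof. by apply: sumr_ge0 => i _; exact: sqr_ge0. Qed.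

Lemma potential_init x y : potential x y (fun=> inord q) = #|I|%:R.
Proof.
rewrite /potential -sum1_card natr_sum; apply: eq_bigr => i _.
rewrite /lev inordK; last by lia.
rewrite mulfV ?pnatr_eq0 -?lt0n // subrr sub0r sqrrN /sgb.
by case: (y i); rewrite ?sqrrN expr1n.
Qed.

Lemma exists_run x y s beta gam :
  S s -> (forall i, s (x i) = Some (sgb R (y i))) ->
  0 < beta -> 16 <= q%:R * beta -> gam <= beta / 32 -> boost_params m N T gam ->
  (0 < #|I|)%N ->
  exists cs : (q ^ 2).-tuple (option code),
    no_violation x y (#|I|%:R * (beta / 2 + 4 * eta)) (run x y cs).
Proof.
move=> Ss sx beta0 qb gamb bp I0.
have /andP[e0 e1] := eta1.
set th := #|I|%:R * (beta / 2 + 4 * eta).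
have imp k : ~ no_violation x y th k ->
    exists c : code, potential x y (step S B eta m sgn x y k c) <=
      potential x y k - #|I|%:R / q%:R ^+ 2.
  move=> /existsNP[b /existsNP[sg /not_implyP[Bb /negP]]]; rewrite -ltNge => viol.
  exact: (improvement binS vcSB rB e0 (sgn := sgn) q0 Ss sx Bb beta0 qb gamb bp e1 I0 viol).
have q2 : 0 < q%:R ^+ 2 :> R by rewrite exprn_gt0 // ltr0n.
have n0 : 0 < #|I|%:R :> R by rewrite ltr0n.
(* Either the run has already stopped and is padded by [None], or each of the [j] rounds has lowered
   the potential. *)
have claim j : (exists cs : j.-tuple (option code), no_violation x y th (run x y cs)) \/
    (exists cs : j.-tuple (option code),
       potential x y (run x y cs) <= #|I|%:R - j%:R * (#|I|%:R / q%:R ^+ 2)).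
  elim: j => [|j [[cs ok]|[cs pot]]].
  - by right; exists [tuple]; rewrite mul0r subr0 /run /= potential_init.
  - by left; exists [tuple of rcons cs None]; rewrite /run /= foldl_rcons.
  - have [ok|/imp[c cP]] := pselect (no_violation x y th (run x y cs)).
      by left; exists [tuple of rcons cs None]; rewrite /run /= foldl_rcons.
    right; exists [tuple of rcons cs (Some c)]; rewrite /run /= foldl_rcons.
    apply: le_trans cP _; rewrite -natr1 mulrDl mul1r opprD addrA; exact: lerB.
(* After [q ^ 2] rounds without stopping the potential is at most 0, so a further improvement would
   make it negative. *)
have [//|[cs pot]] := claim (q ^ 2)%N; exists cs; apply: contrapT => /imp[c].
have := potential_ge0 x y (step S B eta m sgn x y (run x y cs) c).
move: pot; rewrite natrX mulrCA mulfV ?gt_eqF // mulr1 subrr.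
have : 0 < #|I|%:R / q%:R ^+ 2 :> R by rewrite divr_gt0.
lra.
Qed.

Definition round_indices (oc : option code) : seq I :=
  if oc is Some c then flatten [seq codom z.1 | z : {ffun 'I_N -> I} * 'I_N <- c.2] else [::].

Definition used_indices (cs : seq (option code)) : seq I := flatten (map round_indices cs).

Lemma size_used_indices cs : (size (used_indices cs) <= size cs * (T * N))%N.
Proof.
rewrite /used_indices size_flatten /shape -map_comp sumnE big_map.
apply: (@leq_trans (\sum_(oc <- cs) T * N)%N); last first.
  by rewrite big_const_seq iter_addn_0 count_predT mulnC.
apply: leq_sum => -[c|] _ //=.
rewrite size_flatten /shape -map_comp sumnE big_map.
apply: (@leq_trans (\sum_(z <- c.2) N)%N).
  by apply: leq_sum => z _ /=; rewrite size_codom card_ord.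
by rewrite big_const_seq iter_addn_0 count_predT size_tuple mulnC.
Qed.

(** This locality leaves the other sample points independent of the decoded hypothesis. *)
Lemma run_used_indices x y x' y' cs :
  {in used_indices cs, x =1 x'} -> {in used_indices cs, y =1 y'} -> run x y cs = run x' y' cs.
Proof.
rewrite /run; elim: cs (fun=> inord q) => [//|oc cs IH] k ex ey /=.
have -> : (if oc is Some c then step S B eta m sgn x y k c else k) =
    (if oc is Some c then step S B eta m sgn x' y' k c else k).
  case: oc ex ey => [c|] // ex ey; apply/funext => u; rewrite /step; congr nudge.
  rewrite /hyp /vote; congr (_ < 2 * _)%N; apply: eq_in_count => z zc.
  have zs k' : z.1 k' \in used_indices (Some c :: cs).
    rewrite /used_indices /= mem_cat; apply/orP; left; apply/flattenP.
    by exists (codom z.1); [exact: map_f|exact: codom_f].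
  rewrite /decode; congr weakh; apply/funext => k' /=.
    exact: ex.
  exact: ey.
by apply: IH => i ic; [apply: ex|apply: ey]; rewrite /used_indices /= mem_cat ic orbT.
Qed.

End Run.

(** * The compression learner and its generalization bound *)

Section Learner.
Variables (R : realType) (X : Type) (S B : set (X -> option R)) (eta beta delta gam : R) (m : nat).
Hypotheses (binS : binary_class S) (vcSB : VC_le S B eta m) (rB : real_class B).
Hypotheses (eta1 : 0 <= eta <= 1 / 2) (beta1 : 0 < beta <= 1 / 2).
Variables (q : nat) (Sig : finType) (sgn : Sig -> 'I_(2 * q).+1 -> bool).
Hypothesis q0 : (0 < q)%N.
Variables (n N T : nat).
Hypotheses (n0 : (0 < n)%N) (qb : 16 <= q%:R * beta) (gamb : gam <= beta / 32)
  (bp : boost_params m N T gam).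

Local Notation code := (round_code q Sig 'I_n N T).
Local Notation codes := ((q ^ 2).-tuple (option code)).
Local Notation run := (@run R X S B eta m q Sig sgn 'I_n N T).

Implicit Types smp : n.-tuple (X * R).

Definition points smp (i : 'I_n) : X := (tnth smp i).1.
Definition labels smp (i : 'I_n) : bool := 0 < (tnth smp i).2.

Definition state smp (cs : codes) : X -> 'I_(2 * q).+1 := run (points smp) (labels smp) cs.

Definition passes smp (cs : codes) :=
  no_violation B sgn (points smp) (labels smp) (n%:R * (beta / 2 + 4 * eta)) (state smp cs).

(** For a realizable distribution the default is reached only on samples of probability 0. *)
Definition chosen smp : codes :=
  match pselect (exists cs, passes smp cs) with
  | left e => projT1 (cid e)
  | right _ => nseq_tuple _ None
  end.

Definition learner smp (u : X) : R := lev R (state smp (chosen smp) u).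

Variables (p : nat -> R) (a : nat -> X * R).
Hypotheses (dd : is_ddist p a) (rl : realizable S p a).

Let p0 i : 0 <= p i. Proof. by have [] := dd. Qed.
Let p1 : \esum_(i in [set: nat]) (p i)%:E = 1%E. Proof. by have [_ []] := dd. Qed.

Let eps := beta + 4 * eta.

Definition violated (k : X -> 'I_(2 * q).+1) (bs : (X -> option R) * Sig) :=
  B bs.1 /\ eps < mean p (test_fun a (fun u => lev R (k u)) bs.1 (fun u => sgb R (sgn bs.2 (k u)))).

(** The violating pair is a function of [k] alone. Hence the witness is fixed before the fresh
    points are drawn, and no union bound over the possibly infinite [B] arises. *)
Definition witness (k : X -> 'I_(2 * q).+1) : nat -> R :=
  match pselect (exists bs, violated k bs) with
  | left e => let bs := projT1 (cid e) in
      test_fun a (fun u => lev R (k u)) bs.1 (fun u => sgb R (sgn bs.2 (k u)))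
  | right _ => fun=> 0
  end.

Lemma witness_bound k j : `|witness k j| <= 2.
Proof.
rewrite /witness; case: pselect => [e|_]; last by rewrite normr0.
case: (cid e) => -[b s] /= [Bb _]; apply: (test_fun_norm dd rB) => // u.
  exact: lev_bound.
by rewrite norm_sgb.
Qed.

Lemma witness_mean k : (exists bs, violated k bs) -> eps <= mean p (witness k).
Proof. by rewrite /witness; case: pselect => // e _; case: (cid e) => bs /= [_ /ltW]. Qed.

Lemma tprob_label (t : n.-tuple nat) : tprob p t != 0 ->
  exists2 s, S s & forall i, s (points (map_tuple a t) i) = Some (sgb R (labels (map_tuple a t) i))
    /\ (a (tnth t i)).2 = sgb R (labels (map_tuple a t) i).
Proof.
move=> pt; have [s Ss sP] := realizable_label dd binS rl; exists s => // i.
have pi : 0 < p (tnth t i).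
  rewrite lt_neqAle p0 andbT eq_sym; apply: contraNneq pt => pi.
  by rewrite /tprob (bigD1 i) //= pi mul0r.
have [h1 h2] := sP _ pi; rewrite /points /labels tnth_map.
by split; rewrite -?h2.
Qed.

Lemma passes_witness (t : n.-tuple nat) cs : tprob p t != 0 ->
  passes (map_tuple a t) cs -> (exists bs, violated (state (map_tuple a t) cs) bs) ->
  \sum_i witness (state (map_tuple a t) cs) (tnth t i) <= n%:R * (beta / 2 + 4 * eta).
Proof.
move=> /tprob_label[s _ sP] ok ex; rewrite /witness; case: pselect => // e.
case: (cid e) => -[b sg] /= [Bb _]; apply: le_trans (ok b sg Bb).
rewrite le_eqVlt; apply/orP; left; apply/eqP; apply: eq_bigr => i _.
by rewrite /test_fun (sP i).2 /points tnth_map.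
Qed.

(** Close to the minimiser, about [beta / 212], of [41 * lam ^+ 2 - 31 / 80 * beta * lam]; this
    value gives at most [- beta ^+ 2 / 2000]. *)
Let lam := beta / 256.

Definition bad (t : n.-tuple nat) (cs : codes) : bool :=
  `[< [/\ tprob p t != 0, passes (map_tuple a t) cs &
    exists bs, violated (state (map_tuple a t) cs) bs] >].

Hypothesis small : 40 * (q ^ 2 * (T * N))%:R <= n%:R * beta.

(* The hypothesis coded by cs depends on at most beta n / 40 of the points; the other points are
   a fresh sample for it, so Chernoff's bound applies. *)
Lemma bad_prob cs :
  (\esum_(t in [set: n.-tuple nat]) (tprob p t * (bad t cs)%:R)%:E <=
   (expR (- (n%:R * beta ^+ 2 / 2000)))%:E)%E.
Proof.
pose D := [seq i <- enum 'I_n | i \notin used_indices cs].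
pose st t := state (map_tuple a t) cs.
(* It depends on [t] only through the decoded hypothesis, and is 0 when there is nothing to
   refute. *)
pose phi t j := if `[< exists bs, violated (st t) bs >]
  then expR (lam * (eps - witness (st t) j)) else 0.
have uD : uniq D by rewrite filter_uniq // enum_uniq.
have stD t i j : i \in D -> st (tset t i j) = st t.
  rewrite mem_filter => /andP[iD _]; apply: run_used_indices => k ks;
    rewrite /points /labels (tnth_map a (tset t i j)) tnth_tset tnth_map; case: eqP => // ki;
    by rewrite -ki ks in iD.
have phi0 t j : 0 <= phi t j by rewrite /phi; case: ifP => _ //; exact: expR_ge0.
have phir t : (\esum_(j in [set: nat]) (p j * phi t j)%:E <= (1 + 41 * lam ^+ 2)%:E)%E.
  rewrite /phi; case: asboolP => [ex|_]; last first.
    rewrite esum1 ?lee_fin; last by move=> j _; rewrite mulr0.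
    by rewrite addr_ge0 // mulr_ge0 // sqr_ge0.
  apply: (mgf_bound p0 p1) => //.
  - by move: beta1; rewrite /lam; lra.
  - by move: eta1 beta1; rewrite /eps; lra.
  - exact: witness_bound.
  - exact: witness_mean.
have phiD t i j : i \in D -> phi (tset t i j) = phi t.
  by move=> iD; rewrite /phi stD.
have main := esum_prod_le p0 p1 uD phi0 phiD phir.
(* Passing leaves a gap of [n * beta / 2 = 40 / 80 * n * beta] between [eps] and the witness. The at
   most [n * beta / 40] used points account for at most [9 / 2] each, that is [9 / 80 * n * beta];
   the remaining 31/80 comes from fresh points. *)
pose c := lam * (31 / 80 * (n%:R * beta)).
have key t : tprob p t * (bad t cs)%:R <=
    expR (- c) * (tprob p t * \prod_(i <- D) phi t (tnth t i)).
  have pt0 := tprob_ge0 p0 t.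
  rewrite /bad; case: asboolP => [[pt ok ex]|_]; last first.
    by rewrite mulr0 mulr_ge0 ?expR_ge0 // mulr_ge0 //; apply: prodr_ge0.
  rewrite mulr1 mulrCA -{1}[tprob p t]mulr1 ler_wpM2l //.
  have -> : \prod_(i <- D) phi t (tnth t i) =
      expR (\sum_(i <- D) lam * (eps - witness (st t) (tnth t i))).
    rewrite expR_sum; apply: eq_bigr => i _; rewrite /phi; by case: asboolP.
  rewrite -expRD -[X in X <= _]expR0 ler_expR addrC subr_ge0 /c -mulr_sumr ler_wpM2l //.
    by move: beta1; rewrite /lam; lra.
  have tot : \sum_(i < n) (eps - witness (st t) (tnth t i)) =
     \sum_(i <- D) (eps - witness (st t) (tnth t i)) +
     \sum_(i <- [seq i <- enum 'I_n | i \in used_indices cs]) (eps - witness (st t) (tnth t i)).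
    rewrite /D !big_filter !big_enum_cond.
    by rewrite (bigID (fun i => i \in used_indices cs)) /= addrC.
  have := passes_witness pt ok ex; rewrite -/(st t) => pw.
  have tl : n%:R * (beta / 2) <= \sum_(i < n) (eps - witness (st t) (tnth t i)).
    by rewrite sumrB sumr_const card_ord -[eps *+ n]mulr_natl /eps; lra.
  have rest : \sum_(i <- [seq i <- enum 'I_n | i \in used_indices cs])
      (eps - witness (st t) (tnth t i)) <= (q ^ 2 * (T * N))%:R * (9 / 2).
    apply: (@le_trans _ _ (\sum_(i <- [seq i <- enum 'I_n | i \in used_indices cs]) (9 / 2))).
      apply: ler_sum => i _; have := witness_bound (st t) (tnth t i).
      by move: eta1 beta1; rewrite ler_norml /eps; lra.
    rewrite big_const_seq iter_addr addr0 count_predT -[leLHS]mulr_natl ler_wpM2r //.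
    have := size_used_indices cs; rewrite size_tuple ler_nat; apply: leq_trans.
    apply: uniq_leq_size; first by rewrite filter_uniq // enum_uniq.
    by move=> i; rewrite mem_filter => /andP[].
  by move: small tl rest; rewrite tot; lra.
apply: (@le_trans _ _ (\esum_(t in [set: n.-tuple nat])
   ((expR (- c))%:E * (tprob p t * \prod_(i <- D) phi t (tnth t i))%:E))%E).
  by apply: le_esum => t _; rewrite -EFinM lee_fin key.
rewrite esumZ ?expR_gt0 //; last first.
  by move=> t; rewrite lee_fin mulr_ge0 ?tprob_ge0 //; apply: prodr_ge0.
apply: (@le_trans _ _ ((expR (- c))%:E * ((1 + 41 * lam ^+ 2) ^+ size D)%:E)%E).
  by apply: lee_wpmul2l => //; rewrite lee_fin expR_ge0.
rewrite -EFinM lee_fin.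
have l2 : 0 <= 41 * lam ^+ 2 by rewrite mulr_ge0 // sqr_ge0.
apply: (@le_trans _ _ (expR (- c) * expR (41 * lam ^+ 2) ^+ n)).
  rewrite ler_wpM2l ?expR_ge0 //; apply: (@le_trans _ _ (expR (41 * lam ^+ 2) ^+ size D)).
    by rewrite lerXn2r ?nnegrE ?expR_ge0 ?expR_ge1Dx // addr_ge0.
  rewrite ler_weXn2l //; first by apply: le_trans (expR_ge1Dx _); rewrite lerDl.
  by rewrite -[X in (_ <= X)%N]card_ord cardE size_filter count_size.
rewrite -expRM_natl -expRD ler_expR /c /lam.
have nb : 0 <= n%:R * beta ^+ 2 by rewrite mulr_ge0 // sqr_ge0.
lra.
Qed.

Lemma learner_bad (t : n.-tuple nat) : tprob p t != 0 ->
  (exists bs, violated (state (map_tuple a t) (chosen (map_tuple a t))) bs) ->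
  bad t (chosen (map_tuple a t)).
Proof.
move=> pt ex; apply/asboolP; split=> //; rewrite /chosen; case: pselect => [e|[]].
  exact: (projT2 (cid e)).
have [s Ss sP] := tprob_label pt; move: eta1 beta1 => /andP[? ?] /andP[? _].
have e1 : 0 <= eta <= 1 by apply/andP; split; lra.
have b0 : 0 < beta by [].
have I0 : (0 < #|'I_n|)%N by rewrite card_ord.
have [cs] := exists_run binS vcSB rB e1 sgn q0 Ss (fun i => (sP i).1) b0 qb gamb bp I0.
by rewrite card_ord => csP; exists cs; apply: csP.
Qed.

(** Union bound over all codes, since the chosen one depends on the sample. The predicate [good] is
    abstract in order to serve both notions of error. *)
Lemma learner_success (good : (X -> R) -> Prop) :
  (forall k, ~ good (fun u => lev R (k u)) -> exists bs, violated k bs) ->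
  (#|{: code}|.+1 ^ (q ^ 2))%:R * expR (- (n%:R * beta ^+ 2 / 2000)) <= delta ->
  ((1 - delta)%:E <= sample_prob p (fun t => good (learner (map_tuple a t))))%E.
Proof.
move=> gv cnt.
pose G := [set t : n.-tuple nat | good (learner (map_tuple a t))].
have tp0 (t : n.-tuple nat) : (0 <= (tprob p t)%:E)%E by rewrite lee_fin tprob_ge0.
have tot := esum_tprob p0 p1 n.
rewrite (esumID G) // !setTI in tot.
have badG : (\esum_(t in ~` G) (tprob p t)%:E <= delta%:E)%E.
  apply: (@le_trans _ _ (\esum_(t in [set: n.-tuple nat])
      \sum_(cs : codes) (tprob p t * (bad t cs)%:R)%:E)%E).
    rewrite esum_mkcond; apply: le_esum => t _; rewrite sumEFin.
    have s0 cs : 0 <= tprob p t * (bad t cs)%:R by rewrite mulr_ge0 // tprob_ge0.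
    case: ifPn => [/set_mem nG|_]; last by rewrite lee_fin sumr_ge0.
    have [->|pt] := eqVneq (tprob p t) 0; first by rewrite lee_fin sumr_ge0 // => cs _; rewrite mul0r.
    rewrite lee_fin (bigD1 (chosen (map_tuple a t))) //= learner_bad //; last exact: gv.
    by rewrite mulr1 lerDl sumr_ge0.
  rewrite esum_sum; last by move=> t cs _ _; rewrite lee_fin mulr_ge0 // tprob_ge0.
  apply: (@le_trans _ _ (\sum_(cs : codes) (expR (- (n%:R * beta ^+ 2 / 2000)))%:E)%E).
    by apply: lee_sum => cs _; exact: bad_prob.
  rewrite sumEFin lee_fin sumr_const card_tuple card_option -[leLHS]mulr_natl.
  exact: cnt.
rewrite EFinB -tot leeBlDr //; apply: leeD => //.
Qed.

End Learner.

(** * Solving for the sample size *)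

Section SampleSize.
Variable R : realType.
Implicit Types (beta delta : R).

Lemma ln2_ge : 1 / 2 <= ln 2 :> R.
Proof.
have := @le_ln1Dx R (- (1 / 2)) _.
have -> : 1 + - (1 / 2) = 2^-1 :> R by field.
by rewrite lnV ?posrE //; move=> /(_ ltac:(lra)); lra.
Qed.

(** The code length contains [ln n], so the condition on [n] is implicit; this bound absorbs
    [w * ln n] into half of [n]. *)
Lemma ln_le_affine (z w : R) : 0 < z -> 0 < w -> w * ln z <= z / 2 + w * ln (2 * w).
Proof.
move=> z0 w0; have w2 : 0 < 2 * w by rewrite mulr_gt0.
have := ln_sublinear (divr_gt0 z0 w2); rewrite ln_div ?posrE // => h.
have : w * (ln z - ln (2 * w)) <= w * (z / (2 * w)) by rewrite ler_wpM2l // ltW.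
have -> : w * (z / (2 * w)) = z / 2 by field; rewrite gt_eqF.
by rewrite mulrBr; lra.
Qed.

Lemma ln_nat_ge0 (k : nat) : 0 <= ln k%:R :> R.
Proof.
case: k => [|k]; first by rewrite ln0.
by rewrite ln_ge0 // ler1n.
Qed.

Lemma expR_ln_nat (k : nat) : (0 < k)%N -> expR (ln k%:R) = k%:R :> R.
Proof. by move=> k0; rewrite lnK // posrE ltr0n. Qed.

Section Count.
Variables (beta delta : R) (q N T G n : nat).
Hypotheses (beta1 : 0 < beta <= 1) (delta1 : 0 < delta <= 1).
Hypotheses (q0 : (0 < q)%N) (N0 : (0 < N)%N) (T0 : (0 < T)%N) (G0 : (0 < G)%N) (n0 : (0 < n)%N).

Definition index_cost : R := 2000 * (q ^ 2 * (T * N))%:R / beta ^+ 2.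

(** The union bound asks for [n >= 2000 / beta ^+ 2 * ( ... ) + index_cost * ln n]. Replacing the
    last term through [ln_le_affine] and doubling gives this expression. *)
Definition needed_size : R :=
  4000 / beta ^+ 2 * ((q ^ 2)%:R * (ln 2 + ln G%:R + ln q%:R + T%:R * ln N%:R) + ln (1 / delta))
  + 2 * index_cost * ln (2 * index_cost).

Hypothesis nP : needed_size <= n%:R.

Let b0 : 0 < beta. Proof. by case/andP: beta1. Qed.
Let b2 : 0 < beta ^+ 2. Proof. by rewrite exprn_gt0. Qed.

Lemma index_cost_ge : 2000 <= index_cost.
Proof.
rewrite /index_cost (ler_pdivlMr _ _ b2).
have : 1 <= (q ^ 2 * (T * N))%:R :> R by rewrite ler1n !muln_gt0 q0 T0 N0.
have : beta ^+ 2 <= 1 by move: beta1; nra.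
lra.
Qed.

Lemma ln_index_cost : 1 <= ln (2 * index_cost).
Proof.
have h : 4 <= 2 * index_cost by have := index_cost_ge; lra.
apply: (@le_trans _ _ (ln 4)); last by rewrite ler_ln ?posrE //; lra.
have -> : 4 = 2 * 2 :> R by rewrite -natrM.
by rewrite lnM ?posrE //; have := ln2_ge; lra.
Qed.

Lemma few_indices : 40 * (q ^ 2 * (T * N))%:R <= n%:R * beta.
Proof.
have cE : 2000 * (q ^ 2 * (T * N))%:R = index_cost * beta ^+ 2.
  by rewrite /index_cost mulfVK ?(gt_eqF b2).
have := index_cost_ge; have := ln_index_cost; set P := index_cost in cE * => l1 P0.
have d0 : 0 <= ln (1 / delta).
  by rewrite ln_ge0 // ler_pdivlMr ?mul1r; case/andP: delta1.
have nP' : 2 * P <= n%:R.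
  apply: le_trans nP; rewrite /needed_size -/P.
  have t0 : 0 <= 4000 / beta ^+ 2 *
     ((q ^ 2)%:R * (ln 2 + ln G%:R + ln q%:R + T%:R * ln N%:R) + ln (1 / delta)).
    apply: mulr_ge0; first by apply: divr_ge0; [lra|exact: ltW].
    apply: addr_ge0 => //; apply: mulr_ge0; first exact: ler0n.
    apply: addr_ge0; last by apply: mulr_ge0; [exact: ler0n|exact: ln_nat_ge0].
    by have := ln2_ge; have := ln_nat_ge0 G; have := ln_nat_ge0 q; lra.
  have : 2 * P * 1 <= 2 * P * ln (2 * P) by apply: ler_wpM2l => //; lra.
  by lra.
have : 2 * P * beta <= n%:R * beta by apply: ler_wpM2r => //; exact: ltW.
have : P * beta ^+ 2 <= P * beta.
  apply: ler_wpM2l; first by lra.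
  by move: beta1; nra.
have : 0 <= P * beta by apply: mulr_ge0; [lra|exact: ltW].
by lra.
Qed.

Lemma count_codes :
  ((G * q * (n ^ N * N) ^ T).+1 ^ (q ^ 2))%:R * expR (- (n%:R * beta ^+ 2 / 2000)) <= delta.
Proof.
have d0 : 0 < delta by case/andP: delta1.
(* The summand [ln 2] pays for the [.+1], the idle code. *)
pose E : R := ln 2 + ln G%:R + ln q%:R + (T%:R * (N%:R * ln n%:R + ln N%:R)).
have codes : (G * q * (n ^ N * N) ^ T).+1%:R <= expR E.
  apply: (@le_trans _ _ (2 * (G * q * (n ^ N * N) ^ T)%:R)).
    have : 1 <= (G * q * (n ^ N * N) ^ T)%:R :> R.
      by rewrite ler1n !muln_gt0 G0 q0 expn_gt0 muln_gt0 N0 expn_gt0 n0.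
    by rewrite -natr1; lra.
  rewrite /E !expRD expRM_natl expRD expRM_natl !expR_ln_nat //.
  by rewrite !natrM !natrX natrM natrX !mulrA.
rewrite natrX; apply: (@le_trans _ _ (expR E ^+ (q ^ 2) * expR (- (n%:R * beta ^+ 2 / 2000)))).
  apply: ler_wpM2r; first exact: expR_ge0.
  by rewrite lerXn2r ?nnegrE ?expR_ge0 ?ler0n.
rewrite -expRM_natl -expRD -[leRHS]lnK ?posrE // ler_expR.
have ld : ln (1 / delta) = - ln delta by rewrite div1r lnV ?posrE.
have npos : 0 < n%:R :> R by rewrite ltr0n.
have P0 : 0 < index_cost by have := index_cost_ge; lra.
have lnn := ln_le_affine npos P0.
have PE : index_cost * ln n%:R * (beta ^+ 2 / 2000) = (q ^ 2)%:R * (T%:R * (N%:R * ln n%:R)).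
  by rewrite /index_cost !natrM; field; rewrite gt_eqF.
have b2' : 0 <= beta ^+ 2 / 2000 by apply: divr_ge0; [exact: ltW|lra].
have lnn' := ler_wpM2r b2' lnn; rewrite PE in lnn'.
have nP' := ler_wpM2r b2' nP.
have NE : needed_size * (beta ^+ 2 / 2000) =
    2 * ((q ^ 2)%:R * (ln 2 + ln G%:R + ln q%:R + T%:R * ln N%:R) + ln (1 / delta))
    + 2 * (index_cost * ln (2 * index_cost) * (beta ^+ 2 / 2000)).
  by rewrite /needed_size; field; rewrite gt_eqF.
rewrite NE ld in nP'; rewrite /E.
lra.
Qed.

End Count.
End SampleSize.

(** * Choice of the parameters and the resulting cost *)

Section ParameterChoice.
Variable R : realType.
Variables (beta eta delta : R) (m : nat).
Hypotheses (beta1 : 0 < beta < 1 / 2) (eta1 : 0 < eta < 1 / 2) (delta1 : 0 < delta < 1 / 2).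

Local Notation b := beta^-1.
Local Notation Lam := (ln beta^-1).
Local Notation K := (ln (1 / (eta * beta * delta))).

Lemma exists_ceil (x : R) : 0 <= x -> exists2 k : nat, (0 < k)%N & x <= k%:R <= x + 1.
Proof.
move=> x0; exists (Num.truncn x).+1 => //.
have /andP[h1 h2] := truncn_itv x0.
by rewrite ltW //= -natr1 lerD2r.
Qed.

Let b0 : 0 < beta. Proof. by case/andP: beta1. Qed.
Let bi0 : 0 < b. Proof. by rewrite invr_gt0. Qed.
Let b2 : 2 <= b.
Proof. by rewrite -[2]invrK lef_pV2 ?posrE ?invr_gt0 //; move: beta1; lra. Qed.

Lemma ln2_le_Lam : ln 2 <= Lam.
Proof. by rewrite ler_ln ?posrE. Qed.

Lemma KE : K = ln eta^-1 + Lam + ln delta^-1.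
Proof.
have e0 : 0 < eta by case/andP: eta1.
have d0 : 0 < delta by case/andP: delta1.
by rewrite div1r !invfM !lnM ?posrE ?mulr_gt0 ?invr_gt0.
Qed.

Lemma Lam_delta_le_K : Lam + ln (1 / delta) <= K.
Proof.
rewrite KE div1r -addrA lerDr ln_ge0 // invf_ge1; by move: eta1; lra.
Qed.

Lemma ln_inv_delta_ge0 : 0 <= ln (1 / delta).
Proof. by rewrite div1r ln_ge0 // invf_ge1; move: delta1; lra. Qed.

Lemma exists_levels : exists q : nat, [/\ (0 < q)%N, 16 <= q%:R * beta & q%:R <= 17 * b].
Proof.
have [|q q0 /andP[h1 h2]] := @exists_ceil (16 * b); first by apply: mulr_ge0; [lra|exact: ltW].
exists q; split=> //; last by have := b2; lra.
by rewrite -ler_pdivrMr.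
Qed.

Definition weak_params (N T : nat) :=
  (m = 0%N /\ N = 1%N /\ T = 1%N) \/ [/\ (0 < m)%N, N = (8 * m)%N, (0 < T)%N & T%:R <= 50 * Lam].

Lemma exists_weak_params : exists N T, weak_params N T /\ boost_params m N T (beta / 32).
Proof.
have [m0|m0] := posnP m.
  exists 1%N, 1%N; split; first by left.
  by left; do 3?split=> //; apply: divr_ge0; [exact: ltW|lra].
have l2 := @ln2_ge R; have l2L := ln2_le_Lam.
have l32 : ln (32 * b) = 5 * ln 2 + Lam.
  have -> : 32 = 2 ^+ 5 :> R by rewrite -natrX.
  by rewrite lnM ?posrE ?exprn_gt0 // lnXn // mulr_natl.
(* As [7 / 8 <= expR (- (1 / 8))], the choice [T >= 8 * ln (32 * b)] gives
   [(7 / 8) ^+ T <= beta / 32]. After rounding up, [T <= 48 * Lam + 1 <= 50 * Lam]. *)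
have [|T T0 /andP[h1 h2]] := @exists_ceil (8 * ln (32 * b)); first by lra.
exists (8 * m)%N, T; split; first by right; split=> //; lra.
right; split=> //; first by rewrite muln_gt0.
have : (7 / 8) ^+ T <= expR (- (1 / 8)) ^+ T :> R.
  apply: lerXn2r; rewrite ?nnegrE ?expR_ge0 //.
  by apply: le_trans (expR_ge1Dx _); lra.
move=> /le_trans; apply; rewrite -expRM_natl.
have -> : beta / 32 = expR (- ln (32 * b)).
  have p32 : 0 < 32 * b by apply: mulr_gt0; [lra|exact: bi0].
  by rewrite expRN lnK ?posrE // invfM invrK mulrC.
by rewrite ler_expR; lra.
Qed.

Let l2 := @ln2_ge R.
Let l2L := ln2_le_Lam.

Lemma ln2_le1 : ln 2 <= 1 :> R.
Proof.
have -> : 2 = 1 + 1 :> R by [].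
by apply: le_ln1Dx; lra.
Qed.

Lemma logp_ge : (0 < m)%N -> ln m%:R + Lam <= logp (m%:R / beta).
Proof.
move=> m0; have m1 : 1 <= m%:R :> R by rewrite ler1n.
have mb : 2 <= m%:R / beta.
  by apply: le_trans b2 _; rewrite ler_peMl // ltW.
rewrite /logp (max_idPr mb) -lnM ?posrE ?ltr0n // ler_pdivlMr; last by move: l2; lra.
rewrite ler_piMr ?ln2_le1 // ln_ge0 //; lra.
Qed.

Lemma xlnx_le (u v L : R) : 1 <= u -> u <= v -> ln v <= L -> u * ln u <= v * L.
Proof.
move=> u1 uv vL; apply: (@le_trans _ _ (v * ln u)).
  by apply: ler_wpM2r => //; exact: ln_ge0.
apply: ler_wpM2l; first by lra.
by apply: le_trans vL; rewrite ler_ln ?posrE //; lra.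
Qed.

Lemma cost_arith (A Y : R) (q N T G : nat) : 1 <= Y -> Y <= A -> ln A <= 21 * ln 2 + 4 * Lam ->
  ln q%:R <= 5 * ln 2 + Lam -> weak_params N T ->
  Y * (ln 2 + ln G%:R + ln q%:R + T%:R * ln N%:R) + A * ln (1 / delta)
    + (Y * (T * N)%:R) * ln (Y * (T * N)%:R) <=
  150 * 100 * A * (m%:R * logp (m%:R / beta) ^+ 2 + K) + A * ln G%:R.
Proof.
move=> Y1 YA lnA lq wp.
have dK := Lam_delta_le_K; have d0 := ln_inv_delta_ge0.
have G0' := @ln_nat_ge0 R G; have lq0 := @ln_nat_ge0 R q.
have [l2' l2L'] := (l2, l2L); have bi1 := b2.
have L0 : 1 / 2 <= Lam by lra.
have A0 : 0 <= A by lra.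
have S0 : 0 <= T%:R * ln N%:R :> R by apply: mulr_ge0; [exact: ler0n|exact: ln_nat_ge0].
have first_part : Y * (ln 2 + ln G%:R + ln q%:R + T%:R * ln N%:R) <=
    A * (7 * Lam + ln G%:R + T%:R * ln N%:R).
  apply: (@le_trans _ _ (A * (ln 2 + ln G%:R + ln q%:R + T%:R * ln N%:R))).
    by apply: ler_wpM2r => //; lra.
  by apply: ler_wpM2l => //; lra.
have AK : A * (Lam + ln (1 / delta)) <= A * K by apply: ler_wpM2l.
have AL : 0 <= A * Lam by apply: mulr_ge0 => //; lra.
have Ad : 0 <= A * ln (1 / delta) by apply: mulr_ge0.
(* For [m = 0] both [T] and [N] are 1 and a single logarithm remains, which [K] covers. Otherwise
   [T] and the logarithm of the index cost each bring one factor of order [ell]. *)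
case: wp => [[m0 [N1 T1]]|[m0 NE T0 TL]].
  have := @xlnx_le Y A (25 * Lam) Y1 YA.
  move: first_part; rewrite N1 T1 m0 muln1 !mulr1 ln1 mulr0 addr0 !mul0r add0r.
  by move=> first_part /(_ ltac:(lra)); lra.
set M := m%:R; have M1 : 1 <= M by rewrite ler1n.
have Mp : 0 < M by lra.
pose ell := ln M + Lam.
have lM : 0 <= ln M by exact: ln_nat_ge0.
have Lell : Lam <= ell by rewrite lerDr.
have ell0 : 0 <= ell by lra.
have ellp : M * ell ^+ 2 <= M * logp (M / beta) ^+ 2.
  have lp := logp_ge m0; apply: ler_wpM2l; first by lra.
  by apply: lerXn2r => //; rewrite ?nnegrE //; apply: le_trans lp.
have lnN : ln N%:R <= 3 * ell.
  have -> : N%:R = 2 ^+ 3 * M by rewrite NE natrM -natrX.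
  rewrite lnM ?posrE ?exprn_gt0 //.
  have -> : ln (2 ^+ 3) = 3 * ln 2 :> R by rewrite lnXn // mulr_natl.
  by rewrite /ell; lra.
have T1 : 1 <= T%:R :> R by rewrite ler1n.
have N1 : 1 <= N%:R :> R by rewrite NE ler1n muln_gt0.
have TlnN : T%:R * ln N%:R <= 150 * (M * ell ^+ 2).
  apply: (@le_trans _ _ (50 * ell * (3 * ell))).
    by apply: ler_pM => //; [exact: ln_nat_ge0|lra].
  have : ell ^+ 2 <= M * ell ^+ 2 by rewrite ler_peMl ?sqr_ge0.
  by lra.
have TN : (T * N)%:R <= 400 * (M * Lam).
  rewrite natrM NE natrM -/M.
  have : T%:R * M <= 50 * Lam * M by apply: ler_wpM2r => //; lra.
  by lra.
have TN1 : 1 <= (T * N)%:R :> R by rewrite ler1n muln_gt0 T0 NE muln_gt0 m0.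
have cost1 : 1 <= Y * (T * N)%:R by apply: mulr_ege1.
have costv : Y * (T * N)%:R <= A * (400 * (M * Lam)).
  by apply: ler_pM => //; lra.
have p0 : 0 < A by lra.
have Lp : 0 < Lam by lra.
have lnv : ln (A * (400 * (M * Lam))) <= 35 * ell.
  have l400 : ln 400 <= 9 * ln 2 :> R.
    have -> : 9 * ln 2 = ln (2 ^+ 9) :> R by rewrite lnXn // mulr_natl.
    by rewrite ler_ln ?posrE; [lra|lra|rewrite exprn_gt0].
  have lL := ln_sublinear Lp.
  have p400 : 0 < 400 :> R by rewrite ltr0n.
  have pML := mulr_gt0 Mp Lp; have p4ML := mulr_gt0 p400 pML.
  rewrite lnM ?posrE; [|exact: p0|exact: p4ML].
  rewrite lnM ?posrE; [|exact: p400|exact: pML].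
  rewrite lnM ?posrE; [|exact: Mp|exact: Lp].
  by rewrite /ell; lra.
(* This term yields [400 * 35 = 14000] times [A * (M * ell ^+ 2)]; together with the 150 from [TlnN]
   it stays below [150 * 100]. *)
have big := xlnx_le cost1 costv lnv.
have Mell : M * Lam * ell <= M * ell ^+ 2.
  by rewrite -mulrA expr2; apply: ler_wpM2l; [lra|apply: ler_wpM2r].
have AMell : A * (M * Lam * ell) <= A * (M * ell ^+ 2) by apply: ler_wpM2l.
have ATln : A * (T%:R * ln N%:R) <= A * (150 * (M * ell ^+ 2)) by apply: ler_wpM2l.
have Aellp : A * (M * ell ^+ 2) <= A * (M * logp (M / beta) ^+ 2) by apply: ler_wpM2l.
have AM0 : 0 <= A * (M * ell ^+ 2).
  by apply: mulr_ge0 => //; apply: mulr_ge0; [lra|exact: sqr_ge0].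
lra.
Qed.

Lemma needed_size_le (q N T G : nat) : (0 < q)%N -> q%:R <= 17 * b -> weak_params N T ->
  needed_size beta delta q N T G <=
  150 * 100 * (289 * 4000 * b ^+ 4) * (m%:R * logp (m%:R / beta) ^+ 2 + K)
    + (289 * 4000 * b ^+ 4) * ln G%:R.
Proof.
move=> q0 qb wp.
have bp : 0 < b ^+ 4 by rewrite exprn_gt0.
have d0 := ln_inv_delta_ge0.
have q2 : q%:R ^+ 2 <= 289 * b ^+ 2.
  have -> : 289 * b ^+ 2 = (17 * b) ^+ 2 by ring.
  by apply: lerXn2r => //; rewrite ?nnegrE ?ler0n //; apply: le_trans qb.
have bq1 : 1 <= b ^+ 2 * q%:R ^+ 2.
  have q1 : 1 <= q%:R ^+ 2 :> R by rewrite -natrX ler1n expn_gt0 q0.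
  by apply: mulr_ege1; [move: b2; nra|exact: q1].
have lq : ln q%:R <= 5 * ln 2 + Lam.
  have -> : 5 * ln 2 + Lam = ln (2 ^+ 5 * b).
    by rewrite lnM ?posrE ?exprn_gt0 // lnXn // mulr_natl.
  rewrite ler_ln ?posrE ?mulr_gt0 ?exprn_gt0 ?ltr0n //; apply: le_trans qb _.
  by apply: ler_wpM2r; [exact: ltW|lra].
have bq2 : b ^+ 2 * q%:R ^+ 2 <= 289 * b ^+ 4.
  have -> : 289 * b ^+ 4 = b ^+ 2 * (289 * b ^+ 2) by ring.
  by apply: ler_wpM2l; [exact: sqr_ge0|exact: q2].
have tail : b ^+ 2 * ln (1 / delta) <= b ^+ 4 * ln (1 / delta).
  apply: ler_wpM2r; first exact: d0.
  have b21 : 1 <= b ^+ 2 by move: b2; nra.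
  have -> : b ^+ 4 = b ^+ 2 * b ^+ 2 by rewrite -exprD.
  by rewrite ler_peMr ?sqr_ge0.
have tail0 : 0 <= b ^+ 4 * ln (1 / delta) by apply: mulr_ge0; [exact: ltW|exact: d0].
(* [289 = 17 ^ 2] comes from [q <= 17 * b]; the bound on [ln A] below uses
   [289 * 4000 <= 2 ^ 21]. *)
pose Y := 4000 * (b ^+ 2 * q%:R ^+ 2); pose A := 289 * 4000 * b ^+ 4.
have Y1 : 1 <= Y by rewrite /Y; lra.
have YA : Y <= A by rewrite /Y /A; lra.
have lnA : ln A <= 21 * ln 2 + 4 * Lam.
  have -> : 21 * ln 2 + 4 * Lam = ln (2 ^+ 21 * b ^+ 4).
    rewrite lnM ?posrE ?exprn_gt0 // lnXn; last exact: ltr0n.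
    by rewrite lnXn; [rewrite !mulr_natl|exact: bi0].
  have A0 : 0 < A by lra.
  rewrite ler_ln ?posrE; [|exact: A0|by rewrite mulr_gt0 ?exprn_gt0].
  by rewrite /A; apply: ler_wpM2r; [exact: ltW|lra].
have costE : 2 * index_cost beta q N T = Y * (T * N)%:R.
  by rewrite /index_cost /Y exprVn natrM natrX; ring.
have tailA : 4000 * (b ^+ 2 * ln (1 / delta)) <= A * ln (1 / delta) by rewrite /A; lra.
have := cost_arith G Y1 YA lnA lq wp.
rewrite /needed_size costE natrX -exprVn.
have -> (x d : R) : 4000 * b ^+ 2 * (q%:R ^+ 2 * x + d) = Y * x + 4000 * (b ^+ 2 * d).
  by rewrite /Y; ring.
by rewrite -/A; apply: le_trans; rewrite lerD2r lerD2l.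
Qed.

End ParameterChoice.

Lemma needed_size_bound (R : realType) : exists2 c : R, 0 < c &
  forall (beta eta delta : R) (m q N T G : nat),
    0 < beta < 1 / 2 -> 0 < eta < 1 / 2 -> 0 < delta < 1 / 2 ->
    (0 < q)%N -> q%:R <= 17 * beta^-1 -> weak_params beta m N T ->
    needed_size beta delta q N T G <=
      150 * 100 * (c * beta^-1 ^+ 4) *
        (m%:R * logp (m%:R / beta) ^+ 2 + ln (1 / (eta * beta * delta)))
      + (c * beta^-1 ^+ 4) * ln G%:R.
Proof.
exists (289 * 4000); first by rewrite mulr_gt0 ?ltr0n.
by move=> *; exact: needed_size_le.
Qed.

(** * Existence of the learners and the final bounds *)

Section Existence.
Variables (R : realType) (c : R).
Hypothesis c0 : 0 < c.
Hypothesis cP : forall (beta eta delta : R) (m q N T G : nat),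
    0 < beta < 1 / 2 -> 0 < eta < 1 / 2 -> 0 < delta < 1 / 2 ->
    (0 < q)%N -> q%:R <= 17 * beta^-1 -> weak_params beta m N T ->
    needed_size beta delta q N T G <=
      150 * 100 * (c * beta^-1 ^+ 4) *
        (m%:R * logp (m%:R / beta) ^+ 2 + ln (1 / (eta * beta * delta)))
      + (c * beta^-1 ^+ 4) * ln G%:R.
Variables (X : Type) (S B : set (X -> option R)) (beta eta delta : R) (m : nat).
Hypotheses (binS : binary_class S) (rB : real_class B) (vcSB : VC_le S B eta m).
Hypotheses (beta1 : 0 < beta < 1 / 2) (eta1 : 0 < eta < 1 / 2) (delta1 : 0 < delta < 1 / 2).
Variables (q : nat) (Sig : finType) (sgn : Sig -> 'I_(2 * q).+1 -> bool).
Hypotheses (q0 : (0 < q)%N) (qb : 16 <= q%:R * beta) (qb' : q%:R <= 17 * beta^-1)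
  (Sig0 : (0 < #|Sig|)%N).
Variable good : (nat -> R) -> (nat -> X * R) -> (X -> R) -> Prop.
Hypothesis viol : forall p a k, is_ddist p a -> ~ good p a (fun u => lev R (k u)) ->
  exists bs, violated B eta beta sgn p a k bs.

Local Notation K := (ln (1 / (eta * beta * delta))).

Lemma learner_exists : exists n : nat,
  n%:R <= 150 * 100 * (c * beta^-1 ^+ 4) * (m%:R * logp (m%:R / beta) ^+ 2 + K)
    + c * beta^-1 ^+ 4 * ln #|Sig|%:R + 1 /\
  exists A : n.-tuple (X * R) -> X -> R,
    (forall smp, exists k : X -> 'I_(2 * q).+1, A smp = fun u => lev R (k u)) /\
    forall p a, is_ddist p a -> realizable S p a ->
      ((1 - delta)%:E <= sample_prob p (fun t => good p a (A (map_tuple a t))))%E.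
Proof.
have [N [T [wp bp]]] := exists_weak_params m beta1.
have nsz := cP #|Sig| beta1 eta1 delta1 q0 qb' wp.
set U := _ + _ in nsz.
have [b0 bh] := andP beta1; have [e0 eh] := andP eta1; have [d0 dh] := andP delta1.
have K0 : 0 <= K.
  have := Lam_delta_le_K beta1 eta1 delta1; have := ln_inv_delta_ge0 delta1.
  by have := ln2_le_Lam beta1; have := @ln2_ge R; lra.
have cb : 0 <= c * beta^-1 ^+ 4.
  by apply: mulr_ge0; [exact: ltW|apply: exprn_ge0; rewrite invr_ge0 ltW].
have U0 : 0 <= U.
  apply: addr_ge0; last by apply: mulr_ge0 => //; exact: ln_nat_ge0.
  apply: mulr_ge0; first by apply: mulr_ge0 => //; rewrite mulr_ge0 ?ler0n.
  by apply: addr_ge0 => //; apply: mulr_ge0; [exact: ler0n|exact: sqr_ge0].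
have [n n0 /andP[Un nU]] := exists_ceil U0.
exists n; split; first by [].
have [N0 T0] : (0 < N)%N /\ (0 < T)%N.
  by case: wp => [[_ [-> ->]]|[m0 -> ? _]]; rewrite ?muln_gt0.
have beta2 : 0 < beta <= 1 by apply/andP; split; lra.
have delta2 : 0 < delta <= 1 by apply/andP; split; lra.
have beta3 : 0 < beta <= 1 / 2 by apply/andP; split; lra.
have eta3 : 0 <= eta <= 1 / 2 by apply/andP; split; lra.
have nn := le_trans nsz Un.
have few := few_indices beta2 delta2 q0 N0 T0 nn.
have cnt := count_codes beta2 delta2 q0 N0 T0 Sig0 n0 nn.
exists (@learner R X S B eta beta m q Sig sgn n N T); split.
  by move=> smp; eexists.
move=> p a dd rl.
apply: (learner_success binS vcSB rB eta3 beta3 q0 n0 qb (lexx _) bp dd rl few (good := good p a)).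
  by move=> k h; exact: (viol dd h).
by rewrite !card_prod card_ord card_tuple card_prod card_ffun !card_ord.
Qed.

End Existence.

Theorem theorem5p4 (R : realType) :
  exists C : R, 0 < C /\
  forall (X : Type) (S B : set (X -> option R)) (beta eta2 delta : R) (m : nat),
    inhabited X -> binary_class S -> real_class B ->
    0 < beta < 1/2 -> 0 < eta2 < 1/2 -> 0 < delta < 1/2 ->
    VC_le S B eta2 m ->
    (exists n : nat,
       n%:R <= C * (m%:R / beta ^+ 4 * logp (m%:R / beta) ^+ 2
                    + 1 / beta ^+ 4 * ln (1 / (eta2 * beta * delta))) /\
       exists A, MA_learner S B (beta + 4 * eta2) delta (n:=n) A) /\
    (exists n : nat,
       n%:R <= C * (m%:R / beta ^+ 4 * logp (m%:R / beta) ^+ 2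
                    + 1 / beta ^+ 4 * ln (1 / (eta2 * beta * delta))
                    + 1 / beta ^+ 5) /\
       exists A, MC_learner S B (beta + 4 * eta2) delta (n:=n) A).
Proof.
have [c c0 cP] := needed_size_bound R.
(* [51 * c] covers the cost of the signs, and 2 covers the rounding of [n], since
   [b4 * K >= 1 / 2]. *)
exists (150 * 100 * c + 51 * c + 2); split.
  by rewrite !addr_gt0 ?mulr_gt0 ?ltr0n.
move=> X S B beta eta delta m _ binS rB beta1 eta1 delta1 vcSB.
have [q [q0 qb qb']] := exists_levels beta1.
pose K := ln (1 / (eta * beta * delta)).
pose b4 := beta^-1 ^+ 4.
pose L := m%:R * logp (m%:R / beta) ^+ 2.
have [b0 bh] := andP beta1.
have bi2 : 2 <= beta^-1 by rewrite -[2]invrK lef_pV2 ?posrE ?invr_gt0 //; lra.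
have b41 : 1 <= b4 by rewrite exprn_ege1 //; lra.
have l2K : ln 2 <= K.
  have := Lam_delta_le_K beta1 eta1 delta1; have := ln_inv_delta_ge0 delta1.
  by have := ln2_le_Lam beta1; rewrite -/K; lra.
have K2 : 1 / 2 <= K by apply: le_trans l2K; exact: ln2_ge.
have L0 : 0 <= L by apply: mulr_ge0; [exact: ler0n|exact: sqr_ge0].
have bK : 1 / 2 <= b4 * K.
  have h0 : 0 <= 1 / 2 :> R by lra.
  by have := ler_pM ler01 h0 b41 K2; rewrite mul1r.
have b40 : 0 <= b4 by apply: le_trans b41.
have bL : 0 <= b4 * L by apply: mulr_ge0.
have cbL : 0 <= c * (b4 * L) by apply: mulr_ge0 => //; exact: ltW.
have cbK : 0 <= c * (b4 * K) by apply: mulr_ge0; [exact: ltW|apply: le_trans bK; lra].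
have e4 : m%:R / beta ^+ 4 * logp (m%:R / beta) ^+ 2 + 1 / beta ^+ 4 * K = b4 * L + b4 * K.
  by rewrite /b4 /L exprVn; ring.
split.
(* One global sign per round: its cost [ln 2] is at most [K]. *)
- pose sgn (s : bool) (_ : 'I_(2 * q).+1) := s.
  have G0 : (0 < #|{: bool}|)%N by rewrite card_bool.
  have [|n [nle [A [Alev AP]]]] := learner_exists c0 cP binS rB vcSB beta1 eta1 delta1
    (sgn := sgn) q0 qb qb' G0
    (good := fun p a f => (MA_error p a B f <= (beta + 4 * eta)%:E)%E).
    move=> p a k dd nMA.
    have [b [s [Bb bs]]] := MA_violation dd rB (fun x => lev_bound R q0 (k x)) nMA.
    by exists (b, s).
  exists n; split.
    rewrite -/K e4; apply: le_trans nle _; rewrite -/K -/L -/b4 card_bool.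
    have : c * b4 * ln 2 <= c * (b4 * K).
      rewrite -mulrA; apply: ler_wpM2l; first exact: ltW.
      by apply: ler_wpM2l.
    lra.
  exists A; split=> // smp x; have [k ->] := Alev smp; exact: lev_bound.
(* One sign per level: there are [2 ^ (2 * q + 1)] choices, whose logarithm is of order [1 / beta]
   and produces the extra [1 / beta ^+ 5]. *)
- pose sgn (s : {ffun 'I_(2 * q).+1 -> bool}) (i : 'I_(2 * q).+1) := s i.
  have G0 : (0 < #|{: {ffun 'I_(2 * q).+1 -> bool}}|)%N.
    by rewrite card_ffun card_bool expn_gt0.
  have [|n [nle [A [Alev AP]]]] := learner_exists c0 cP binS rB vcSB beta1 eta1 delta1
    (sgn := sgn) q0 qb qb' G0
    (good := fun p a f => (MC_error p a B f <= (beta + 4 * eta)%:E)%E).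
    move=> p a k dd nMC.
    have [b [s [Bb bs]]] := MC_violation dd rB (fun x => lev_bound R q0 (k x))
      (@lev_inj R q q0) (fun x => erefl) nMC.
    by exists (b, s).
  exists n; split.
    rewrite -/K e4; apply: le_trans nle _; rewrite -/K -/L -/b4.
    have -> : 1 / beta ^+ 5 = b4 * beta^-1 by rewrite /b4 -exprSr exprVn div1r.
    have bb : 0 <= b4 * beta^-1 by apply: mulr_ge0 => //; apply: le_trans bi2.
    have : c * b4 * ln #|{: {ffun 'I_(2 * q).+1 -> bool}}|%:R <= c * (b4 * (51 * beta^-1)).
      rewrite -mulrA; apply: ler_wpM2l; first exact: ltW.
      apply: ler_wpM2l; first exact: b40.
      rewrite card_ffun card_bool card_ord natrX lnXn ?ltr0n // -[ln 2 *+ _]mulr_natl.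
      have q1 : 1 <= q%:R :> R by rewrite ler1n.
      apply: (@le_trans _ _ ((2 * q).+1%:R * 1)).
        by apply: ler_wpM2l; [exact: ler0n|exact: ln2_le1].
      rewrite mulr1 -natr1 natrM; lra.
    have : 0 <= c * (b4 * beta^-1) by apply: mulr_ge0 => //; exact: ltW.
    have : 0 <= 150 * 100 * (c * (b4 * beta^-1)).
      by apply: mulr_ge0; [rewrite mulr_ge0 ?ler0n|apply: mulr_ge0 => //; exact: ltW].
    lra.
  exists A; split; first by move=> smp x; have [k ->] := Alev smp; exact: lev_bound.
  split=> // smp; have [k ->] := Alev smp.
  apply: finite_set_countable; apply: (@sub_finite_set _ _ (range (@lev R q))).
    by move=> _ [x _ <-]; exists (k x).
  by apply: finite_image; exact: finite_finset.
Qed.
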